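(* Let $X\subset\mathbb{P}^1\times\mathbb{P}^1$ be a nonempty finite set of points. Let $m$ be the maximum number of points of $X$ on a single horizontal ruling, and let $n$ be the maximum number of points of $X$ on a single vertical ruling. If $|X|<mn$ and $\gcd(m,n)$ does not divide $|X|$, then $X$ is not a virtual complete intersection.
   Context: Let $\Bbbk$ be an algebraically closed field; $\mathbb{P}^1\times\mathbb{P}^1$ is over $\Bbbk$, with projections $\pi_1,\pi_2$ to the first and second factor. A vertical ruling is a fiber of $\pi_1$ and a horizontal ruling is a fiber of $\pi_2$. The Cox ring is $S=\Bbbk[x_0,x_1,y_0,y_1]$, $\mathbb{Z}^2$-graded with $\deg x_i=(1,0)$ and $\deg y_i=(0,1)$, and $B=\langle x_0,x_1\rangle\cap\langle y_0,y_1\rangle$ is the irrelevant ideal. A set of points means a reduced zero-dimensional subscheme $X$ of $\mathbb{P}^1\times\mathbb{P}^1$; $I_X\subset S$ is the $B$-saturated bihomogeneous ideal of polynomials vanishing on $X$. A virtual resolution of $S/I$ ($I$ a bihomogeneous ideal) is a $\mathbb{Z}^2$-graded complex of free $S$-modules $F_\bullet=[F_0\xleftarrow{\varphi_1}F_1\xleftarrow{\varphi_2}F_2\leftarrow\cdots]$ such that for every $i\ge 1$ the annihilator of $H_i(F_\bullet)$ contains $B^\ell$ for some $\ell>0$, and the sheaves on $\mathbb{P}^1\times\mathbb{P}^1$ associated to $S/I$ and $\operatorname{coker}(\varphi_1)$ are isomorphic. The set $X$ is a virtual complete intersection (VCI) if $S/I_X$ has a virtual resolution that is the Koszul complex $K(f,g)$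 of two bihomogeneous forms $f,g\in S$. *)

(* Defs.v *)
From HB Require Import structures.
From mathcomp Require Import all_boot all_order all_algebra.
From mathcomp Require Import finmap.
From mathcomp Require Import mpoly.

Set Implicit Arguments.
Unset Strict Implicit.
Unset Printing Implicit Defensive.

Import GRing.Theory.
Local Open Scope ring_scope.

(** ** The Cox ring of P^1 x P^1 *)

(* Writing the number of variables as 2 + 2 lets [lshift]/[rshift] and [row_mx]
   separate the x-variables from the y-variables. *)
Notation cox k := {mpoly k[2 + 2]}.

Section CoxRing.
Variable k : closedFieldType.
Implicit Types (p : cox k) (d : int * int).

Definition xvar (i : 'I_2) : cox k := 'X_(lshift 2 i).
Definition yvar (i : 'I_2) : cox k := 'X_(rshift 2 i).

Definition mbideg (e : 'X_{1..2 + 2}) : int * int :=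
  ((\sum_(i < 2) e (lshift 2 i))%N%:Z, (\sum_(i < 2) e (rshift 2 i))%N%:Z).

(* The zero polynomial is bihomogeneous of every degree. *)
Definition bihomog d p : bool := all (fun e => mbideg e == d) (msupp p).

Definition ideal_gen n (g : 'I_n -> cox k) p : Prop :=
  exists c : 'I_n -> cox k, p = \sum_(i < n) c i * g i.

Definition ideal_mul (I J : cox k -> Prop) p : Prop :=
  exists n (a b : 'I_n -> cox k),
    [/\ forall i, I (a i), forall i, J (b i) & p = \sum_(i < n) a i * b i].

Fixpoint ideal_pow (I : cox k -> Prop) (l : nat) : cox k -> Prop :=
  if l is l'.+1 then ideal_mul I (ideal_pow I l') else fun=> True.

Definition irrelevant p : Prop := ideal_gen xvar p /\ ideal_gen yvar p.

End CoxRing.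

(** ** Points of P^1 x P^1 *)

Section Points.
Variable k : closedFieldType.

(* A point of P^1 is a line through the origin of k^2. As k is algebraically
   closed, pairs of such lines are exactly the closed points of P^1 x P^1, and
   the reduced zero-dimensional subschemes are the finite sets of them. *)
Definition P1 := {l : {vspace 'rV[k]_2} | \dim l == 1%N}.
Definition P1xP1 := (P1 * P1)%type.

Definition vanishes (f : cox k) (z : P1xP1) : Prop :=
  forall v w : 'rV[k]_2, <[v]>%VS = val z.1 -> <[w]>%VS = val z.2 ->
    f.@[row_mx v w 0] = 0.

Definition vertical_ruling (p : P1) : pred P1xP1 := fun z => z.1 == p.
Definition horizontal_ruling (q : P1) : pred P1xP1 := fun z => z.2 == q.

Definition count_on (X : {fset P1xP1}) (L : pred P1xP1) : nat :=
  #|` [fset z in X | L z]%fset|.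

Definition is_max_on (X : {fset P1xP1}) (ruling : P1 -> pred P1xP1) (n : nat) :=
  (exists p, count_on X (ruling p) = n) /\
  (forall p, count_on X (ruling p) <= n)%N.

(* [vanishes] quantifies over all choices of homogeneous coordinates, and k is
   infinite, so a polynomial is in this ideal iff all its bihomogeneous
   components are: the ideal is bihomogeneous and B-saturated. *)
Definition vanishing_ideal (X : {fset P1xP1}) (f : cox k) : Prop :=
  forall z, z \in X -> vanishes f z.

Definition zariski_open (U : P1xP1 -> Prop) : Prop :=
  exists G : cox k -> Prop,
    (forall f, G f -> exists d, bihomog d f) /\
    (forall z, U z <-> exists2 f, G f & ~ vanishes f z).

End Points.

(** ** Graded modules and their associated sheaves *)

Section Sheaves.
Variable k : closedFieldType.
Local Notation S := (cox k).

(* The graded module F / N, where F is free on generators e_j of degree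
   [gm_deg j], i.e., the direct sum of the S(- gm_deg j), and N is the graded
   submodule [gm_rel]. *)
Record gmodule := GModule {
  gm_rank : nat;
  gm_deg : 'I_gm_rank -> int * int;
  gm_rel : 'rV[S]_gm_rank -> Prop }.

(* S / I, generated in degree (0, 0) *)
Definition cyclic_module (I : S -> Prop) : gmodule :=
  @GModule 1 (fun=> 0) (fun v => I (v 0 0)).

Definition ring_module : gmodule := cyclic_module (fun p => p = 0).

Definition gm_homog (M : gmodule) (d : int * int) (v : 'rV[S]_(gm_rank M)) :=
  forall j, bihomog (d - gm_deg j) (v 0 j).

(* The sheaf associated to M is described as for Proj: the stalk at z is the
   degree (0, 0) part of the localization of M at the bihomogeneous forms not
   vanishing at z, and a section over U assigns to each point of U an element of
   the stalk there, in a way that is locally given by a single fraction.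
   A pair (v, s) stands for the fraction v / s; elements of the stalk at z are
   the pairs satisfying [in_stalk], up to [stalk_eq]. *)
Definition fraction (M : gmodule) := ('rV[S]_(gm_rank M) * S)%type.

Definition in_stalk (M : gmodule) (z : P1xP1 k) (a : fraction M) : Prop :=
  exists d, [/\ gm_homog d a.1, bihomog d a.2 & ~ vanishes a.2 z].

Definition stalk_eq (M : gmodule) (z : P1xP1 k) (a b : fraction M) : Prop :=
  exists d t, [/\ bihomog d t, ~ vanishes t z
                & gm_rel (t *: (b.2 *: a.1 - a.2 *: b.1))].

Definition fadd (M : gmodule) (a b : fraction M) : fraction M :=
  (b.2 *: a.1 + a.2 *: b.1, a.2 * b.2).

Definition fscale (M : gmodule) (r : fraction ring_module) (a : fraction M) :
  fraction M := (r.1 0 0 *: a.1, r.2 * a.2).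

(* Values outside U are irrelevant, so restriction of sections is the identity
   on the underlying functions. *)
Definition is_section (M : gmodule) (U : P1xP1 k -> Prop)
    (s : P1xP1 k -> fraction M) : Prop :=
  forall z, U z -> exists V a,
    [/\ zariski_open V, V z, forall w, V w -> U w
      & forall w, V w -> [/\ in_stalk w a, in_stalk w (s w)
                           & stalk_eq w (s w) a]].

Definition section_eq (M : gmodule) (U : P1xP1 k -> Prop)
    (s s' : P1xP1 k -> fraction M) : Prop :=
  forall z, U z -> stalk_eq z (s z) (s' z).

(* A family phi U of maps from the sections over U of the sheaf of M to those of
   the sheaf of N is an isomorphism of sheaves of modules over the structure
   sheaf, which is the sheaf of [ring_module]. *)
Record is_sheaf_iso (M N : gmodule)
    (phi : (P1xP1 k -> Prop) ->
           (P1xP1 k -> fraction M) -> (P1xP1 k -> fraction N)) : Prop := {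
  iso_section : forall U s, zariski_open U ->
    is_section U s -> is_section U (phi U s);
  iso_eq : forall U s s', zariski_open U -> is_section U s -> is_section U s' ->
    section_eq U s s' -> section_eq U (phi U s) (phi U s');
  iso_restrict : forall U V s, zariski_open U -> zariski_open V ->
    (forall z, V z -> U z) -> is_section U s ->
    section_eq V (phi V s) (phi U s);
  iso_add : forall U s s', zariski_open U -> is_section U s -> is_section U s' ->
    section_eq U (phi U (fun z => fadd (s z) (s' z)))
                 (fun z => fadd (phi U s z) (phi U s' z));
  iso_scale : forall U (r : P1xP1 k -> fraction ring_module) s,
    zariski_open U -> is_section U r -> is_section U s ->
    section_eq U (phi U (fun z => fscale (r z) (s z)))
                 (fun z => fscale (r z) (phi U s z));
  iso_inj : forall U s s', zariski_open U -> is_section U s -> is_section U s' ->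
    section_eq U (phi U s) (phi U s') -> section_eq U s s';
  iso_surj : forall U t, zariski_open U -> is_section U t ->
    exists2 s, is_section U s & section_eq U (phi U s) t }.

Definition sheaf_isomorphic (M N : gmodule) : Prop :=
  exists phi, @is_sheaf_iso M N phi.

End Sheaves.

(** ** Virtual resolutions *)

Section VirtualResolutions.
Variable k : closedFieldType.
Local Notation S := (cox k).

(* F_i is free on generators of degrees [fc_deg i j]. Elements are row vectors,
   so the map F_(i+1) -> F_i is v |-> v *m fc_diff i. *)
Record free_seq := FreeSeq {
  fc_rank : nat -> nat;
  fc_deg : forall i, 'I_(fc_rank i) -> int * int;
  fc_diff : forall i, 'M[S]_(fc_rank i.+1, fc_rank i) }.

Definition is_graded_complex (F : free_seq) : Prop :=
  (forall i j l, bihomog (fc_deg j - fc_deg l) (fc_diff F i j l)) /\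
  (forall i, fc_diff F i.+1 *m fc_diff F i = 0).

(* [homology_killed_by F i I]: the ideal I annihilates H_(i+1)(F). *)
Definition homology_killed_by (F : free_seq) (i : nat) (I : S -> Prop) : Prop :=
  forall b, I b -> forall z : 'rV_(fc_rank F i.+1), z *m fc_diff F i = 0 ->
    exists y : 'rV_(fc_rank F i.+2), b *: z = y *m fc_diff F i.+1.

Definition coker1 (F : free_seq) : gmodule k :=
  @GModule k (fc_rank F 0) (@fc_deg F 0)
    (fun v => exists y : 'rV_(fc_rank F 1), v = y *m fc_diff F 0).

Definition virtual_resolution (I : S -> Prop) (F : free_seq) : Prop :=
  [/\ is_graded_complex F,
      forall i, exists2 l, (0 < l)%N
        & homology_killed_by F i (ideal_pow (@irrelevant k) l)
    & sheaf_isomorphic (cyclic_module I) (coker1 F)].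

Definition koszul_rank (i : nat) : nat :=
  match i with 0 => 1 | 1 => 2 | 2 => 1 | _ => 0 end.

(* The degrees of the forms f and g are part of the data, as the zero form has
   no well-defined degree. *)
Definition koszul_deg (df dg : int * int) (i : nat) :
    'I_(koszul_rank i) -> int * int :=
  match i with
  | 1 => fun j => if j == 0 :> nat then df else dg
  | 2 => fun=> df + dg
  | _ => fun=> 0
  end.

Definition koszul_diff (f g : S) (i : nat) :
    'M[S]_(koszul_rank i.+1, koszul_rank i) :=
  match i with
  | 0 => \matrix_(j < 2, l < 1) (if j == 0 :> nat then f else g)
  | 1 => \matrix_(j < 1, l < 2) (if l == 0 :> nat then - g else f)
  | _ => 0
  end.

Definition koszul (df dg : int * int) (f g : S) : free_seq :=
  FreeSeq (@koszul_deg df dg) (koszul_diff f g).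

Definition virtual_complete_intersection (X : {fset P1xP1 k}) : Prop :=
  exists df dg f g,
    [/\ bihomog df f, bihomog dg g
      & virtual_resolution (vanishing_ideal X) (koszul df dg f g)].

End VirtualResolutions.

(* Main.v *)
(* An isomorphism between the sheaves of S/I_X and S/(f, g) makes the two ideals agree
   locally: an element that kills one module kills the other up to a form not
   vanishing at a given point. Choose affine coordinates in which X has no point at
   infinity; then f and g, of bidegrees (a, b) and (c, d), become polynomials in x
   and y without common zeros at infinity. Comparing leading coefficients shows that
   all syzygies of f, g and all memberships in (f, g) respect the bidegree bounds,
   so that (f, g) has codimension ad + bc. The local agreement then gives (f, g) =
   I_X, hence |X| = ad + bc. On a vertical line with n points of X either f vanishes
   identically, and then g restricts to a polynomial with exactly these n simple
   zeros, so n = d; or n <= b; the same holds with f and g exchanged, and for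
   horizontal lines. If |X| < mn, the only possibilities left are (m, n) = (c, d)
   and (m, n) = (a, b), and in both gcd(m, n) divides ad + bc. *)
From HB Require Import structures.
Require Import Defs.
From mathcomp Require Import all_boot all_order all_algebra.
From mathcomp Require Import finmap.
From mathcomp Require Import mpoly zify ring.

Set Implicit Arguments.
Unset Strict Implicit.
Unset Printing Implicit Defensive.

Import GRing.Theory.
Local Open Scope ring_scope.

(** * Bivariate polynomials of bounded bidegree *)

Section Bounded.
Variable R : comNzRingType.
Implicit Types (p q : {poly {poly R}}) (i j : nat).

(* [bounded a.+1 b.+1 p]: p has degree at most a in the outer variable x and at most
   b in the inner variable y. *)
Definition bounded i j p :=
  forall r s : nat, ((i <= r) || (j <= s))%N -> p`_r`_s = 0.

Lemma boundedP i j p :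
  bounded i j p <-> (size p <= i)%N /\ forall r, (size (p`_r)%R <= j)%N.
Proof.
split=> [H|[H1 H2] r s /orP[ir|js]].
- split=> [|r]; apply/leq_sizeP => s Hs; last by rewrite H // Hs orbT.
  by apply/polyP => t; rewrite H ?Hs // coef0.
- by move/leq_sizeP: H1 => ->; rewrite ?coef0.
- by move/leq_sizeP: (H2 r) => ->.
Qed.

Lemma bounded0 i j : bounded i j 0.
Proof. by move=> r s _; rewrite !coef0. Qed.

Lemma boundedD i j p q : bounded i j p -> bounded i j q -> bounded i j (p + q).
Proof. by move=> Hp Hq r s Hrs; rewrite !coefD Hp ?Hq ?addr0. Qed.

Lemma boundedN i j p : bounded i j p -> bounded i j (- p).
Proof. by move=> Hp r s Hrs; rewrite !coefN Hp ?oppr0. Qed.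

Lemma boundedW i j i' j' p :
  (i <= i')%N -> (j <= j')%N -> bounded i j p -> bounded i' j' p.
Proof. by move=> Hi Hj H r s Hrs; apply: H; lia. Qed.

Lemma bounded_swap i j p : bounded i j (swapXY p) <-> bounded j i p.
Proof.
by split=> H r s Hrs; [rewrite -coef_swapXY | rewrite coef_swapXY];
  apply: H; rewrite orbC.
Qed.

Lemma bounded_ex p : exists i j, bounded i j p.
Proof.
exists (size p), (\max_(r < size p) size (p`_r)%R); apply/boundedP; split=> // r.
have [rp|pr] := ltnP r (size p); last by rewrite nth_default ?size_poly0.
exact: (@leq_bigmax _ (fun r : 'I_(size p) => size p`_r) (Ordinal rp)).
Qed.

Lemma boundedM i j a b p q :
  bounded i j p -> bounded a.+1 b.+1 q -> bounded (i + a) (j + b) (p * q).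
Proof.
move=> Hp Hq r s Hrs; rewrite coefM coef_sum big1 // => t _; rewrite coefM.
rewrite big1 // => l _.
have [/Hp->|/norP[h1 h2]] := boolP ((i <= t)%N || (j <= l)%N); rewrite ?mul0r//.
rewrite Hq ?mulr0 //; move: h1 h2 Hrs; move: (t : nat) (l : nat) => {}t {}l.
by clear; lia.
Qed.

(** Only the top coefficients of [u] and [f] meet in degree [i]. For [i < a] the truncated bound
    [i.+1 - a] is 0 and forces [u = 0]. *)
Lemma coefM_top (A : comNzRingType) i a (u f : {poly A}) :
  (size u <= i.+1 - a)%N -> (size f <= a.+1)%N ->
  (u * f)`_i = (if (a <= i)%N then u`_(i - a) else 0) * f`_a.
Proof.
move=> Hu Hf; case: leqP => ai.
  rewrite coefM (bigD1 (inord (i - a))) //= inordK ?ltnS ?leq_subr //.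
  rewrite subKn // big1 ?addr0 // => t nt.
  have [lt|] := leqP (size u) t; first by rewrite nth_default ?mul0r.
  move=> tu; rewrite [f`_ _]nth_default ?mulr0 //.
  have: (t : nat) <> (i - a)%N.
    by move=> E; case/eqP: nt; apply/val_inj; rewrite /= inordK // ltnS leq_subr.
  move: (leq_trans tu Hu) => h2 h1; apply: leq_trans Hf _.
  by move: h2 h1; clear -ai; lia.
move: Hu; rewrite (eqP (_ : (i.+1 - a)%N == 0%N)); last by rewrite subn_eq0.
by rewrite leqn0 size_poly_eq0 => /eqP->; rewrite !mul0r coef0.
Qed.

End Bounded.

(** * Syzygies and memberships with bidegree bounds *)

Section Tame.
Variable k : fieldType.
Implicit Types (f g h u v e : {poly {poly k}}).

(** Multiplying the Bezout relation [w1 * p + w2 * q = 1] by [u] and replacing [u * p] by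
    [- (v * q)] makes [q] a factor of [u]. *)
Lemma coprimep_syzygy (p q u v : {poly k}) :
  coprimep p q -> u * p + v * q = 0 -> exists e : {poly k}, u = e * q /\ v = - (e * p).
Proof.
move=> /Bezout_eq1_coprimepP[[w1 w2] /= w] uv.
have E : v * q = - (u * p) by apply/eqP; rewrite -addr_eq0 addrC uv.
exists (u * w2 - v * w1); split; last first.
  rewrite -[LHS]mulr1 -w; ring: E.
rewrite -[LHS]mulr1 -w; ring: E.
Qed.

(* f and g, as forms of bidegrees (a, b) and (c, d), have no common zero on
   x = infinity, on y = infinity, or at the corner. *)
Definition tame (a b c d : nat) f g :=
  [/\ bounded a.+1 b.+1 f, bounded c.+1 d.+1 g, coprimep f`_a g`_c,
      coprimep (swapXY f)`_b (swapXY g)`_d & (f`_a`_b != 0) || (g`_c`_d != 0)].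

Lemma tame_swap a b c d f g :
  tame a b c d f g -> tame b a d c (swapXY f) (swapXY g).
Proof.
by case=> Hf Hg H1 H2 H3; split; rewrite ?swapXYK ?coef_swapXY //;
  apply/bounded_swap.
Qed.

Lemma size_mul_top (e p : {poly k}) b j :
  (size p <= b.+1)%N -> p`_b != 0 -> e != 0 ->
  (size (e * p)%R <= j)%N -> (size e + b <= j)%N.
Proof.
move=> sp pb e0.
suff -> : size (e * p) = (size e + b)%N by [].
have p0 : p != 0 by apply: contraNneq pb => ->; rewrite coef0.
have -> : size (e * p) = (size e + size p).-1 by rewrite size_mul.
suff -> : size p = b.+1 by rewrite addnS.
by apply/eqP; rewrite eqn_leq sp ltnNge; apply: contra pb => /leq_sizeP->.
Qed.

Lemma bounded_lower i j u : bounded i.+1 j u -> u`_i = 0 -> bounded i j u.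
Proof.
move=> H Hi r s /orP[|js]; last by apply: H; rewrite js orbT.
by rewrite leq_eqVlt => /predU1P[<-|ir]; rewrite ?Hi ?coef0 // H ?ir.
Qed.

(** The top x-coefficients of [u] and [v] form a syzygy of the coprime top coefficients of [f] and
    [g], hence come from a single polynomial in y. Subtracting the matching multiple of the Koszul
    syzygy [(g, - f)] lowers both x-bounds. *)
Lemma reduce_step a b c d f g u v i j :
  tame a b c d f g -> (a + c <= i)%N || (j <= b + d)%N ->
  bounded (i.+1 - a) (j - b) u -> bounded (i.+1 - c) (j - d) v ->
  (u * f + v * g)`_i = 0 ->
  exists e, [/\ bounded (i.+1 - (a + c)) (j - (b + d)) e,
    bounded (i - a) (j - b) (u - e * g) & bounded (i - c) (j - d) (v + e * f)].
Proof.
move=> [Hf Hg cop _ corner] ij Hu Hv.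
have [suf sfx] := (boundedP _ _ _).1 Hf; have [sug sgx] := (boundedP _ _ _).1 Hg.
have [suu sux] := (boundedP _ _ _).1 Hu; have [suv svx] := (boundedP _ _ _).1 Hv.
rewrite coefD (coefM_top suu suf) (coefM_top suv sug).
set ut := if _ then _ else _; set vt := if _ then _ else _.
case/(coprimep_syzygy cop) => e [Eu Ev].
have low a' b' (w : {poly {poly k}}) (wt := if (a' <= i)%N then w`_(i - a') else 0) :
    bounded (i.+1 - a') (j - b') w -> wt = 0 -> bounded (i - a') (j - b') w.
  rewrite /wt; case: leqP => ai; first by rewrite subSn //; apply: bounded_lower.
  by move=> Hw _; rewrite (eqP (ltnW ai)); rewrite (eqP ai) in Hw.
have [e0|e0] := eqVneq e 0.
  exists 0; rewrite !mul0r subr0 addr0; split; first exact: bounded0.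
    by apply: low => //; rewrite -/ut Eu e0 mul0r.
  by apply: low => //; rewrite -/vt Ev e0 mul0r oppr0.
have sut : (size ut <= j - b)%N by rewrite /ut; case: ifP; rewrite ?size_poly0.
have svt : (size vt <= j - d)%N by rewrite /vt; case: ifP; rewrite ?size_poly0.
(* By the corner condition the top coefficient of [f] or of [g] has full y-degree, so the y-bound on
   its product with [e] bounds [e]. *)
have ej : (size e + (b + d) <= j)%N.
  have e1 : (0 < size e)%N by rewrite size_poly_gt0.
  case/orP: corner => nz.
    have := size_mul_top (sfx a) nz e0; rewrite -size_polyN -Ev => /(_ _ svt).
    by move: e1; clear; lia.
  have := size_mul_top (sgx c) nz e0; rewrite -Eu => /(_ _ sut).
  by move: e1; clear; lia.
(* As [e] is nonzero, [ej] gives [b + d < j], which leaves only the first alternative of the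
   hypothesis. *)
have aci : (a + c <= i)%N.
  have e1 : (0 < size e)%N by rewrite size_poly_gt0.
  by move: ij ej e1; clear; lia.
have ai : (a <= i)%N by apply: leq_trans aci; apply: leq_addr.
have ci : (c <= i)%N by apply: leq_trans aci; apply: leq_addl.
have HE : bounded (i.+1 - (a + c)) (j - (b + d)) (e%:P * 'X^(i - (a + c))).
  move=> r s; rewrite coefCM coefXn; case: eqP => [->|]; last by rewrite mulr0 coef0.
  rewrite mulr1 subSn // ltnn => js; apply: nth_default.
  by apply: leq_trans js; rewrite leq_subRL ?(addnC _ (size e)) //;
    move: ej; clear; lia.
exists (e%:P * 'X^(i - (a + c))); split=> //.
  apply: bounded_lower.
    rewrite -subSn //; apply: boundedD => //; apply: boundedN.
    by apply: boundedW (boundedM HE Hg); move: aci ej; clear; lia.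
  rewrite coefB -mulrA coefCM coefXnM ltnNge leq_sub2l ?leq_addr //=.
  rewrite (_ : (i - a - (i - (a + c)))%N = c); last by move: aci; clear; lia.
  by rewrite -Eu /ut ai subrr.
apply: bounded_lower.
  rewrite -subSn //; apply: boundedD => //.
  by apply: boundedW (boundedM HE Hf); move: aci ej; clear; lia.
rewrite coefD -mulrA coefCM coefXnM ltnNge leq_sub2l ?leq_addl //=.
rewrite (_ : (i - c - (i - (a + c)))%N = a); last by move: aci; clear; lia.
by rewrite -[e * _]opprK -Ev /vt ci subrr.
Qed.

(** Descending induction on the x-bound, from [i + n] to [i]. Each correction is a Koszul syzygy, so
    [u * f + v * g] never changes and its higher coefficients stay 0. *)
Lemma reduce a b c d f g u v i n j :
  tame a b c d f g -> (a + c <= i)%N || (j <= b + d)%N ->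
  bounded (i + n - a) (j - b) u -> bounded (i + n - c) (j - d) v ->
  (forall r, (i <= r)%N -> (u * f + v * g)`_r = 0) ->
  exists e, [/\ bounded (i + n - (a + c)) (j - (b + d)) e,
    bounded (i - a) (j - b) (u - e * g) & bounded (i - c) (j - d) (v + e * f)].
Proof.
move=> T ij; elim: n u v => [|n IH] u v.
  rewrite addn0 => Hu Hv _; exists 0; rewrite !mul0r subr0 addr0.
  by split=> //; apply: bounded0.
rewrite addnS => Hu Hv H0.
have ij' : (a + c <= i + n)%N || (j <= b + d)%N.
  by case/orP: ij => [ij|->]; rewrite ?orbT // (leq_trans ij) ?leq_addr.
have [e [He Hu' Hv']] := reduce_step T ij' Hu Hv (H0 _ (leq_addr _ _)).
have E : (u - e * g) * f + (v + e * f) * g = u * f + v * g by ring.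
have [|e' [He' Hu'' Hv'']] := IH _ _ Hu' Hv'; first by rewrite E.
exists (e + e'); split; first apply: boundedD => //.
- by apply: boundedW He' => //; apply: leq_sub2r.
- by rewrite mulrDl opprD addrA.
- by rewrite mulrDl addrA.
Qed.

Lemma bounded_nil i u : bounded 0 i u -> u = 0.
Proof. by move=> H; apply/polyP => r; apply/polyP => s; rewrite H ?coef0. Qed.

(** The coefficients [u] and [v] are reduced first in x, then in y after [swapXY]; the second
    reduction keeps the x-bounds reached by the first. *)
Lemma ideal_bounded a b c d f g u v i j :
  tame a b c d f g -> (a + c <= i)%N -> (b + d <= j)%N ->
  bounded i j (u * f + v * g) ->
  exists u' v', [/\ bounded (i - a) (j - b) u', bounded (i - c) (j - d) v'
                  & u' * f + v' * g = u * f + v * g].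
Proof.
move=> T ai bj H.
have [iu [ju Hu]] := bounded_ex u; have [iv [jv Hv]] := bounded_ex v.
(* The slacks [n] and [l] make room for the arbitrary bidegrees of [u] and [v]. *)
pose n := (a + c + iu + iv)%N; pose l := (b + d + ju + jv)%N.
have [|||r ir|e [_ Hu' Hv']] := @reduce a b c d f g u v i n (j + l) T.
- by rewrite ai.
- by apply: boundedW Hu; rewrite /n /l; lia.
- by apply: boundedW Hv; rewrite /n /l; lia.
- by apply/polyP => s; rewrite H ?ir ?coef0.
set u1 := u - _ in Hu'; set v1 := v + _ in Hv'.
have E1 : u1 * f + v1 * g = u * f + v * g by rewrite /u1 /v1; ring.
move: u1 v1 Hu' Hv' E1 => u1 v1 Hu1 Hv1 E1.
have [|||r jr|e' [_ Hu'' Hv'']] :=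
    @reduce b a d c (swapXY f) (swapXY g) (swapXY u1) (swapXY v1) j l i (tame_swap T).
- by rewrite bj.
- exact/bounded_swap.
- exact/bounded_swap.
- rewrite -!rmorphM -rmorphD E1; apply/polyP => s.
  by rewrite coef_swapXY H ?jr ?orbT // coef0.
exists (u1 - swapXY e' * g), (v1 + swapXY e' * f); split; last by rewrite -E1; ring.
  by apply/bounded_swap; rewrite rmorphB rmorphM /= swapXYK.
by apply/bounded_swap; rewrite rmorphD rmorphM /= swapXYK.
Qed.

(** Reduction in x to the bound [a + c] and then in y to the bound 0 leaves nothing of a syzygy, and
    only the first reduction contributes to [e]. *)
Lemma syzygy_bounded a b c d f g u v i j :
  tame a b c d f g -> (a + c <= i)%N ->
  bounded (i - a) (j - b) u -> bounded (i - c) (j - d) v ->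
  u * f + v * g = 0 ->
  exists e, [/\ bounded (i - (a + c)) (j - (b + d)) e, u = e * g & v = - (e * f)].
Proof.
move=> T ai Hu Hv H.
have [|||r ir|e [He Hu' Hv']] := @reduce a b c d f g u v (a + c) (i - (a + c)) j T.
- by rewrite leqnn.
- by rewrite subnKC.
- by rewrite subnKC.
- by rewrite H coef0.
set u1 := u - _ in Hu'; set v1 := v + _ in Hv'.
have E1 : u1 * f + v1 * g = 0 by rewrite -H /u1 /v1; ring.
(* The target y-bound 0 need not reach [b + d]; the side condition of [reduce] holds by its second
   alternative, the x-bound being exactly [a + c]. *)
have [||||e' [He' /bounded_nil Hu'' /bounded_nil Hv'']] :=
    @reduce b a d c (swapXY f) (swapXY g) (swapXY u1) (swapXY v1) 0 j (a + c)
     (tame_swap T).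
- by rewrite leqnn orbT.
- exact/bounded_swap.
- exact/bounded_swap.
- by move=> r _; rewrite -!rmorphM -rmorphD E1 rmorph0 coef0.
(* With u1 and v1 of x-degree below c and a, lowering the y-bounds to 0 leaves no room
   for a nonzero correction e'. *)
have e0 : e' = 0.
  rewrite subnn in He'; apply: (can_inj (@swapXYK _)); rewrite rmorph0.
  by apply: bounded_nil (_ : bounded 0 _ _); apply/bounded_swap; apply: He'.
move: Hu'' Hv''; rewrite e0 !mul0r subr0 addr0 => /eqP + /eqP.
rewrite !raddf_eq0; try exact: (can_inj (@swapXYK _)).
rewrite subr_eq0 addr_eq0 => /eqP-> /eqP->.
by exists e; rewrite subnKC in He.
Qed.

End Tame.

(** * Codimension of the ideal *)

Section Matrices.
Variable k : fieldType.
Implicit Types (f g h u v e p : {poly {poly k}}).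

(** Coefficient matrices stand for the bounded polynomials, so that these form a finite-dimensional
    space of known dimension. *)
Definition mx_poly i j (A : 'M[k]_(i, j)) : {poly {poly k}} :=
  \poly_(r < i) rVpoly (if insub r is Some r' then row r' A else 0).

Definition poly_mx i j p : 'M[k]_(i, j) := \matrix_(r, s) p`_r`_s.

Lemma coef_mx_poly i j (A : 'M[k]_(i, j)) (r : 'I_i) (s : 'I_j) :
  (mx_poly A)`_r`_s = A r s.
Proof. by rewrite coef_poly ltn_ord valK coef_rVpoly_ord mxE. Qed.

Lemma bounded_mx_poly i j (A : 'M[k]_(i, j)) : bounded i j (mx_poly A).
Proof.
move=> r s /orP[ir|js]; rewrite coef_poly; first by rewrite ltnNge ir coef0.
case: ifP => _; last by rewrite coef0.
by rewrite coef_rVpoly; case: insubP => // x; rewrite ltnNge js.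
Qed.

Lemma mx_polyK i j : cancel (@mx_poly i j) (poly_mx i j).
Proof. by move=> A; apply/matrixP => r s; rewrite mxE coef_mx_poly. Qed.

Lemma bounded_eq i j p q : bounded i j p -> bounded i j q ->
  (forall (r : 'I_i) (s : 'I_j), p`_r`_s = q`_r`_s) -> p = q.
Proof.
move=> Hp Hq H; apply/polyP => r; apply/polyP => s.
have [/orP rs|/norP[]] := boolP ((i <= r) || (j <= s))%N.
  by rewrite Hp ?Hq //; apply/orP.
by rewrite -!ltnNge => ri sj; apply: (H (Ordinal ri) (Ordinal sj)).
Qed.

Lemma poly_mxK i j p : bounded i j p -> mx_poly (poly_mx i j p) = p.
Proof.
move=> Hp; apply: bounded_eq Hp _; first exact: bounded_mx_poly.
by move=> r s; rewrite coef_mx_poly mxE.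
Qed.

Lemma mx_polyP i j c (A B : 'M[k]_(i, j)) :
  mx_poly (c *: A + B) = c%:P *: mx_poly A + mx_poly B.
Proof.
apply: (@bounded_eq i j); first exact: bounded_mx_poly.
  apply: boundedD; last exact: bounded_mx_poly.
  by move=> r s rs; rewrite coefZ coefCM bounded_mx_poly ?mulr0.
by move=> r s; rewrite coefD coefZ coefD coefCM !coef_mx_poly !mxE.
Qed.

Lemma mx_poly0 i j : mx_poly (0 : 'M[k]_(i, j)) = 0.
Proof.
apply: (@bounded_eq i j); [exact: bounded_mx_poly | exact: bounded0 |].
by move=> r s; rewrite coef_mx_poly mxE !coef0.
Qed.

Lemma poly_mxP i j c p q :
  poly_mx i j (c%:P *: p + q) = c *: poly_mx i j p + poly_mx i j q.
Proof. by apply/matrixP=> r s; rewrite !mxE coefD coefZ coefD coefCM. Qed.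

Section Maps.
Variables (f g : {poly {poly k}}) (i j i1 j1 i2 j2 : nat).

(** Together with [syz_fun] below, this gives the maps of the Koszul complex of [f] and [g], cut off
    at degree bounds. *)
Definition comb_fun (AB : 'M[k]_(i1, j1) * 'M[k]_(i2, j2)) : 'M[k]_(i, j) :=
  poly_mx i j (mx_poly AB.1 * f + mx_poly AB.2 * g).

Fact comb_fun_linear : linear comb_fun.
Proof.
move=> c A B; rewrite /comb_fun -poly_mxP /= !mx_polyP; congr poly_mx.
by rewrite !mulrDl scalerDr -!scalerAl addrACA.
Qed.
HB.instance Definition _ := GRing.isLinear.Build k _ _ _ comb_fun comb_fun_linear.

Definition syz_fun (A : 'M[k]_(i, j)) : 'M[k]_(i1, j1) * 'M[k]_(i2, j2) :=
  (poly_mx i1 j1 (mx_poly A * g), poly_mx i2 j2 (- (mx_poly A * f))).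

Fact syz_fun_linear : linear syz_fun.
Proof.
move=> c A B; rewrite /syz_fun; congr pair; rewrite /= -poly_mxP mx_polyP.
  by rewrite mulrDl -scalerAl.
by rewrite mulrDl -scalerAl opprD scalerN.
Qed.
HB.instance Definition _ := GRing.isLinear.Build k _ _ _ syz_fun syz_fun_linear.
End Maps.

Definition ideal_mx a b c d f g i j : {vspace 'M[k]_(i, j)} :=
  limg (linfun (@comb_fun f g i j (i - a) (j - b) (i - c) (j - d))).

(** The truncated Koszul complex is exact, so rank-nullity, used twice, gives the dimension [(i -
    a)(j - b) + (i - c)(j - d) - (i - a - c)(j - b - d)], which simplifies to
    [i j - (a d + b c)]. *)
Lemma dim_ideal_mx a b c d f g i j :
  tame a b c d f g -> (a + c <= i)%N -> (b + d <= j)%N ->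
  (\dim (ideal_mx a b c d f g i j) + (a * d + b * c) = i * j)%N.
Proof.
move=> T ai bj; have [Hf Hg _ _ corner] := T.
have Bf u : bounded (i - a) (j - b) u -> bounded i j (u * f).
  by move=> Hu; apply: boundedW (boundedM Hu Hf); lia.
have Bg u : bounded (i - c) (j - d) u -> bounded i j (u * g).
  by move=> Hu; apply: boundedW (boundedM Hu Hg); lia.
pose Phi := linfun (@comb_fun f g i j (i - a) (j - b) (i - c) (j - d)).
pose Psi := linfun (@syz_fun f g (i - (a + c)) (j - (b + d))
                      (i - a) (j - b) (i - c) (j - d)).
have Bu e : bounded (i - (a + c)) (j - (b + d)) e ->
    bounded (i - a) (j - b) (e * g).
  by move=> Hu; apply: boundedW (boundedM Hu Hg); lia.
have Bv e : bounded (i - (a + c)) (j - (b + d)) e ->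
    bounded (i - c) (j - d) (- (e * f)).
  by move=> Hu; apply/boundedN; apply: boundedW (boundedM Hu Hf); lia.
have kerPsi : lker Psi = 0%VS.
  apply/eqP/lker0P => A B; rewrite !lfunE /= /syz_fun => -[E1 E2].
  have {}E1 : mx_poly A * g = mx_poly B * g.
    by move/(congr1 (@mx_poly _ _)): E1; rewrite !poly_mxK //; apply/Bu/bounded_mx_poly.
  have {}E2 : - (mx_poly A * f) = - (mx_poly B * f).
    by move/(congr1 (@mx_poly _ _)): E2; rewrite !poly_mxK //; apply/Bv/bounded_mx_poly.
  apply: (can_inj (@mx_polyK _ _)); case/orP: corner => nz.
    have f0 : f != 0 by apply: contraNneq nz => ->; rewrite !coef0.
    by apply: (mulIf f0); apply: oppr_inj.
  have g0 : g != 0 by apply: contraNneq nz => ->; rewrite !coef0.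
  exact: (mulIf g0).
(* Exactness in the middle comes from [syzygy_bounded]. *)
have kerPhi : lker Phi = limg Psi.
  apply/vspaceP => -[A B]; rewrite memv_ker lfunE /=; apply/eqP/memv_imgP.
    move/(congr1 (@mx_poly _ _)); rewrite poly_mxK; last first.
      by apply: boundedD; [apply: Bf | apply: Bg]; apply: bounded_mx_poly.
    rewrite mx_poly0.
    case/(syzygy_bounded T ai (bounded_mx_poly _) (bounded_mx_poly _)) => e [He EA EB].
    exists (poly_mx _ _ e); rewrite ?memvf // lfunE /= /syz_fun poly_mxK // -EA -EB.
    by rewrite !mx_polyK.
  case=> E _; rewrite lfunE => -[-> ->] /=.
  have BE := bounded_mx_poly E.
  rewrite /comb_fun /= !poly_mxK; [|exact: Bv|exact: Bu].
  by apply/matrixP => r s; rewrite mulNr mulrAC subrr !mxE !coef0.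
have := limg_ker_dim Phi fullv; rewrite capfv kerPhi.
have := limg_ker_dim Psi fullv; rewrite capfv kerPsi dimv0 add0n => ->.
rewrite !dimvf /= /dim /= !dim_matrix -/(ideal_mx _ _ _ _ _ _ _ _) => H.
move: H; move: (\dim _) => D H.
have {}H : ((i - (a + c)) * (j - (b + d)) + D
            = (i - a) * (j - b) + (i - c) * (j - d))%N := H.
(* Writing [i] and [j] as sums removes the truncated subtractions. *)
have [s Es] : exists s : nat, i = (a + c + s)%N by exists (i - (a + c))%N; lia.
have [t Et] : exists t : nat, j = (b + d + t)%N by exists (j - (b + d))%N; lia.
move: H; clear - Es Et; rewrite Es Et.
rewrite (_ : a + c + s - (a + c) = s)%N; last by lia.
rewrite (_ : b + d + t - (b + d) = t)%N; last by lia.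
rewrite (_ : a + c + s - a = c + s)%N; last by lia.
rewrite (_ : a + c + s - c = a + s)%N; last by lia.
rewrite (_ : b + d + t - b = d + t)%N; last by lia.
rewrite (_ : b + d + t - d = b + t)%N; last by lia.
by move=> H; nia.
Qed.

Definition in_ideal f g h := exists u v, h = u * f + v * g.

Lemma in_idealD f g h h' : in_ideal f g h -> in_ideal f g h' -> in_ideal f g (h + h').
Proof.
by move=> [u [v ->]] [u' [v' ->]]; exists (u + u'), (v + v'); ring.
Qed.

Lemma in_idealM f g h p : in_ideal f g h -> in_ideal f g (p * h).
Proof. by move=> [u [v ->]]; exists (p * u), (p * v); ring. Qed.

Lemma in_ideal_swap f g h :
  in_ideal (swapXY f) (swapXY g) (swapXY h) <-> in_ideal f g h.
Proof.
split=> -[u [v E]]; exists (swapXY u), (swapXY v); last by rewrite E rmorphD !rmorphM.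
by apply: (can_inj (@swapXYK _)); rewrite E rmorphD !rmorphM /= !swapXYK.
Qed.

(** By [ideal_bounded], a membership in the full ideal has coefficients within the bounds. *)
Lemma mem_ideal_mx a b c d f g i j (A : 'M_(i, j)) :
  tame a b c d f g -> (a + c <= i)%N -> (b + d <= j)%N ->
  A \in ideal_mx a b c d f g i j <-> in_ideal f g (mx_poly A).
Proof.
move=> T ai bj; have [Hf Hg _ _ _] := T; split.
  case/memv_imgP => -[U V] _; rewrite lfunE /= => ->.
  exists (mx_poly U), (mx_poly V); rewrite poly_mxK //; apply: boundedD.
    by apply: boundedW (boundedM (bounded_mx_poly U) Hf); lia.
  by apply: boundedW (boundedM (bounded_mx_poly V) Hg); lia.
case=> u [v E].
have [|u' [v' [Hu Hv E']]] := @ideal_bounded _ a b c d f g u v i j T ai bj.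
  by rewrite -E; apply: bounded_mx_poly.
apply/memv_imgP; exists (poly_mx _ _ u', poly_mx _ _ v'); rewrite ?memvf // lfunE.
by rewrite /= /comb_fun /= !poly_mxK // E' -E mx_polyK.
Qed.

Section XPoly.
Variables i j n : nat.
Definition xpoly_fun (w : 'rV[k]_n) : 'M[k]_(i, j) :=
  poly_mx i j (map_poly polyC (rVpoly w)).
Fact xpoly_fun_linear : linear xpoly_fun.
Proof.
move=> c A B; rewrite /xpoly_fun -poly_mxP; congr poly_mx.
by apply/polyP => r; rewrite linearP !(coefD, coefZ, coef_map) /= -?mul_polyC
  rmorphD rmorphM.
Qed.
HB.instance Definition _ := GRing.isLinear.Build k _ _ _ xpoly_fun xpoly_fun_linear.
End XPoly.

(** The polynomials in x of degree at most [N] form a space of dimension [N + 1], which exceeds the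
    codimension [N = a d + b c] of the ideal, so the two spaces meet nontrivially. *)
Lemma eliminant a b c d f g :
  tame a b c d f g ->
  exists2 p : {poly k}, p != 0 & in_ideal f g (map_poly polyC p).
Proof.
move=> T; pose N := (a * d + b * c)%N.
pose i := (a + c + N.+1)%N; pose j := (b + d).+1.
pose Chi := linfun (@xpoly_fun i j N.+1).
have Bw (w : 'rV[k]_N.+1) : bounded i j (map_poly polyC (rVpoly w)).
  apply/boundedP; split=> [|r].
    by rewrite size_map_poly (leq_trans (size_poly _ _)) // /i; lia.
  by rewrite coef_map (leq_trans (size_polyC_leq1 _)).
have kerC : lker Chi = 0%VS.
  apply/eqP/lker0P => A B; rewrite !lfunE /= /xpoly_fun.
  move/(congr1 (@mx_poly _ _)); rewrite !poly_mxK // => /map_poly_inj E.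
  by apply: (can_inj rVpolyK); apply: E.
pose U := limg Chi; pose J := ideal_mx a b c d f g i j.
have dU : \dim U = N.+1.
  have := limg_ker_dim Chi fullv; rewrite capfv kerC dimv0 add0n /U => ->.
  by rewrite dimvf /dim /= mul1n.
have ai : (a + c <= i)%N by rewrite leq_addr.
have dJ : (\dim J + N = i * j)%N by apply: dim_ideal_mx => //; rewrite /j; lia.
have [|x] := vpick (U :&: J)%VS =P 0.
  move/eqP; rewrite vpick0 => /eqP cap0.
  have := dimv_sum_cap U J; rewrite cap0 dimv0 addn0 dU.
  have := dimvS (subvf (U + J)%VS); rewrite dimvf /dim /= -dJ.
  by move=> le eq; move: le; rewrite eq addSn addnC ltnn.
have := memv_pick (U :&: J)%VS; rewrite memv_cap => /andP[/memv_imgP[w _ Ew]].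
rewrite {}Ew in x *; rewrite lfunE in x *; rewrite mem_ideal_mx //.
rewrite /= /xpoly_fun poly_mxK // => HJ; exists (rVpoly w) => //.
apply/eqP => w0; apply: x; rewrite /= /xpoly_fun w0 rmorph0.
by apply/matrixP => r s; rewrite !mxE !coef0.
Qed.

End Matrices.

(** * Ideals of points *)

Section Evaluation.
Variable k : fieldType.
Implicit Types (f g h p t : {poly {poly k}}) (z : k * k) (X : seq (k * k)).

Definition ev h z := h.[z.1%:P].[z.2].

Lemma evD h p z : ev (h + p) z = ev h z + ev p z.
Proof. by rewrite /ev !hornerD. Qed.

Lemma evM h p z : ev (h * p) z = ev h z * ev p z.
Proof. by rewrite /ev !hornerM. Qed.

Lemma ev_prod (I : Type) (r : seq I) (P : pred I) F z :
  ev (\prod_(i <- r | P i) F i) z = \prod_(i <- r | P i) ev (F i) z.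
Proof. by rewrite /ev !horner_prod; apply: eq_bigr. Qed.

Lemma ev_x a z : ev ('X - a%:P%:P) z = z.1 - a.
Proof. by rewrite /ev !hornerE. Qed.

Lemma ev_y b z : ev ('X - b%:P)%:P z = z.2 - b.
Proof. by rewrite /ev !hornerE. Qed.

Lemma ev_swap h z : ev (swapXY h) z = ev h (z.2, z.1).
Proof. exact: horner2_swapXY. Qed.

Definition vanish X h := forall z, z \in X -> ev h z = 0.

(** Divide by the linear factor in x, then divide the remainder, a polynomial in y, by the linear
    factor in y. *)
Lemma ev_decompose t z : exists A B,
  t = (ev t z)%:P%:P + A * ('X - z.1%:P%:P) + B * ('X - z.2%:P)%:P.
Proof.
have /factor_theorem[A EA] : root (t - (t.[z.1%:P])%:P) z.1%:P.
  by rewrite rootE !hornerE subrr.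
have /factor_theorem[B EB] : root (t.[z.1%:P] - (ev t z)%:P) z.2.
  by rewrite rootE !hornerE subrr.
exists A, B%:P; rewrite -EA -polyCM -EB polyCB; ring.
Qed.

(** Up to a scalar, the indicator function of [z] on [X]: each other point is killed by a linear
    factor in a coordinate where it differs from [z]. *)
Definition separator X z : {poly {poly k}} :=
  \prod_(m <- X | m != z)
     (if m.1 != z.1 then 'X - m.1%:P%:P else ('X - m.2%:P)%:P).

Lemma separator_neq0 X z : ev (separator X z) z != 0.
Proof.
rewrite /separator ev_prod prodf_seq_neq0; apply/allP => -[m1 m2] _ /=; apply/implyP.
case: z => z1 z2; rewrite xpair_eqE negb_and; case: eqP => [->|/eqP ne _] /=.
  by rewrite ev_y subr_eq0 eq_sym.
by rewrite ev_x subr_eq0 eq_sym.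
Qed.

Lemma separator_eq0 X z w : w \in X -> w != z -> ev (separator X z) w = 0.
Proof.
move=> wX wz; rewrite /separator ev_prod; apply/eqP; rewrite prodf_seq_eq0.
apply/hasP; exists w; rewrite // wz /=.
by case: ifP => _; rewrite ?ev_x ?ev_y subrr.
Qed.

Lemma bounded_separator X z : bounded (size X).+1 (size X).+1 (separator X z).
Proof.
rewrite /separator; elim: X => [|m X IH].
  rewrite big_nil => r s; rewrite coef1; case: eqP => [->|]; last by rewrite coef0.
  by rewrite coef1; case: eqP => [->|].
rewrite big_cons /=; case: ifP => _; last by apply: boundedW IH.
rewrite mulrC -[(size X).+2]addn1; apply: boundedM IH _.
case: ifP => _; apply/boundedP; split=> [|r].
- by rewrite size_XsubC.
- rewrite coefB coefX coefC; case: r => [|[|r]] /=.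
  + by rewrite sub0r size_polyN (leq_trans (size_polyC_leq1 _)).
  + by rewrite subr0 size_poly1.
  + by rewrite subr0 size_poly0.
- by rewrite (leq_trans (size_polyC_leq1 _)).
- by rewrite coefC; case: ifP => _; rewrite ?size_XsubC ?size_poly0.
Qed.

Section EvMap.
Variables (X : seq (k * k)) (i j : nat).
Definition ev_fun (A : 'M[k]_(i, j)) : 'rV[k]_(size X) :=
  \row_l ev (mx_poly A) (nth 0 X l).
Fact ev_fun_linear : linear ev_fun.
Proof.
move=> c A B; apply/rowP => l; rewrite !mxE mx_polyP evD -mul_polyC evM.
by rewrite /ev !hornerC.
Qed.
HB.instance Definition _ := GRing.isLinear.Build k _ _ _ ev_fun ev_fun_linear.
End EvMap.

(** Evaluation at [X] maps the bounded polynomials onto a space of dimension [size X], with kernel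
    the bounded part of the ideal; so [size X] is the codimension found in [dim_ideal_mx]. *)
Lemma card_of_ideal a b c d f g X :
  tame a b c d f g -> uniq X -> (forall h, vanish X h <-> in_ideal f g h) ->
  size X = (a * d + b * c)%N.
Proof.
move=> T uX HX; pose i := (a + c + (size X).+1)%N; pose j := (b + d + (size X).+1)%N.
have ai : (a + c <= i)%N by apply: leq_addr.
have bj : (b + d <= j)%N by apply: leq_addr.
pose E := linfun (@ev_fun X i j).
have kE : lker E = ideal_mx a b c d f g i j.
  apply/vspaceP => A; apply/idP/idP.
    rewrite memv_ker lfunE /= => /eqP/rowP H; rewrite mem_ideal_mx // -HX => z zX.
    have lz : (index z X < size X)%N by rewrite index_mem.
    by have := H (Ordinal lz); rewrite !mxE nth_index.
  rewrite mem_ideal_mx // -HX => H; rewrite memv_ker lfunE; apply/eqP/rowP => l.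
  by rewrite !mxE H // mem_nth.
(* The rescaled separators map to the unit vectors; the summand [(size X).+1] in [i] and [j] makes
   room for them. *)
have iE : limg E = fullv.
  apply/eqP; rewrite eqEsubv subvf /=; apply/subvP => v _.
  rewrite (row_sum_delta v); apply: memv_suml => l _; apply: memvZ.
  apply/memv_imgP; pose z := nth 0 X l; pose L := separator X z.
  exists (poly_mx i j ((ev L z)^-1%:P%:P * L)); rewrite ?memvf // lfunE /=.
  have BL : bounded i j ((ev L z)^-1%:P%:P * L).
    move=> r s rs; rewrite coefCM coefCM (bounded_separator (X := X)) ?mulr0 //.
    by move: rs; rewrite /i /j; lia.
  apply/rowP => l'; rewrite !mxE poly_mxK // evM {1}/ev !hornerC eqxx /=.
  have [->|ne] := eqVneq l' l; first by rewrite mulVf ?separator_neq0.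
  by rewrite [ev L _`_l']separator_eq0 ?mulr0 ?mem_nth // /z nth_uniq.
have := limg_ker_dim E fullv; rewrite capfv kE iE !dimvf /dim /= mul1n => D.
by have := dim_ideal_mx T ai bj; rewrite -D => /addnI.
Qed.
End Evaluation.

(** * From local to global membership in the ideal *)

Section Closed.
Variable k : closedFieldType.
Implicit Types (f g h p t : {poly {poly k}}) (z : k * k) (X : seq (k * k)).

(** A factor may be cancelled only from elements satisfying [V], so [V] has to pass to the products
    with the remaining factors. *)
Lemma cancel_linear (I V : {poly {poly k}} -> Prop) (ell : k -> {poly {poly k}}) :
  (forall h a, V h -> V (ell a * h)) ->
  (forall h a, V h -> I (ell a * h) -> I h) ->
  forall (s : seq k) h, V h -> I (\prod_(a <- s) ell a * h) -> I h.
Proof.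
move=> HV HI; elim=> [|a s IH] h Vh; first by rewrite big_nil mul1r.
have VP : V (\prod_(b <- s) ell b * h).
  by elim: (s) => [|b r IHr]; rewrite ?big_nil ?mul1r // big_cons -mulrA; apply: HV.
by rewrite big_cons -mulrA => /(HI _ _ VP); apply: IH.
Qed.

(* Were some h vanishing on X outside (f, g), multiplying it by the linear
   factors of eliminants p(x), q(y) in (f, g) would produce such an h killed
   modulo (f, g) by x - x0 and y - y0; then a t with t(x0, y0) <> 0 acts on it as a
   nonzero scalar. *)
Lemma ideal_of_local a b c d f g X :
  tame a b c d f g ->
  (forall h z, vanish X h -> exists2 t, ev t z != 0 & in_ideal f g (t * h)) ->
  forall h, vanish X h -> in_ideal f g h.
Proof.
move=> T loc.
have VM h p : vanish X h -> vanish X (p * h).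
  by move=> Vh z zX; rewrite evM Vh ?mulr0.
have H0 h x0 y0 : vanish X h -> in_ideal f g (('X - x0%:P%:P) * h) ->
    in_ideal f g (('X - y0%:P)%:P * h) -> in_ideal f g h.
  move=> Vh Hx Hy; have [t t0 Ht] := loc h (x0, y0) Vh.
  have [A [B Et]] := ev_decompose t (x0, y0).
  have -> : h = (ev t (x0, y0))^-1%:P%:P * (t * h - A * (('X - x0%:P%:P) * h)
                  - B * (('X - y0%:P)%:P * h)).
    rewrite [t in t * h]Et /=.
    have E : (ev t (x0, y0))^-1%:P%:P * (ev t (x0, y0))%:P%:P = 1 :> {poly {poly k}}.
      by rewrite -!polyCM mulVf.
    by rewrite -[LHS]mul1r -E; ring.
  apply: in_idealM; rewrite -!mulNr -addrA; apply: in_idealD => //.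
  by apply: in_idealD; apply: in_idealM.
have [q q0 Hq] := eliminant (tame_swap T).
have [p p0 Hp] := eliminant T.
have {}Hq : in_ideal f g q%:P by apply/in_ideal_swap; rewrite swapXY_polyC.
have [s Es] := closed_field_poly_normal q.
have [r Er] := closed_field_poly_normal p.
(* The eliminant in y removes the assumption of [H0] on the linear factor in y; being killed by the
   one in x is carried along as part of [V]. *)
have H1 h x0 : vanish X h -> in_ideal f g (('X - x0%:P%:P) * h) -> in_ideal f g h.
  move=> Vh Hx.
  apply: (@cancel_linear (in_ideal f g)
    (fun h => vanish X h /\ in_ideal f g (('X - x0%:P%:P) * h))
    (fun b => ('X - b%:P)%:P) _ _ s) => // [h' b' [Vh' Hh']|h' b' [Vh' Hh'] Hb'|].
  - by split; [apply: VM | rewrite mulrCA; apply: in_idealM].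
  - exact: H0 Hh' Hb'.
  have -> : \prod_(y <- s) ('X - y%:P)%:P * h = (lead_coef q)^-1%:P%:P * h * q%:P.
    have -> : q%:P = (lead_coef q)%:P%:P * \prod_(y <- s) ('X - y%:P)%:P.
      by rewrite {1}Es -mul_polyC polyCM rmorph_prod.
    have E : (lead_coef q)^-1%:P%:P * (lead_coef q)%:P%:P = 1 :> {poly {poly k}}.
      by rewrite -!polyCM mulVf ?lead_coef_eq0.
    by rewrite -[LHS]mul1r -E; ring.
  exact: in_idealM.
(* The eliminant in x then removes the remaining assumption of [H1]. *)
move=> h Vh; apply: (@cancel_linear (in_ideal f g) (vanish X)
    (fun a => 'X - a%:P%:P) _ _ r) => // [h' a' Vh'|]; first exact: VM.
have -> : \prod_(x <- r) ('X - x%:P%:P) * h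
          = (lead_coef p)^-1%:P%:P * h * map_poly polyC p.
  have -> : map_poly polyC p = (lead_coef p)%:P%:P * \prod_(x <- r) ('X - x%:P%:P).
    rewrite {1}Er -mul_polyC rmorphM /= map_polyC rmorph_prod /=; congr (_ * _).
    by apply: eq_bigr => x _; rewrite rmorphB /= map_polyX map_polyC.
  have E : (lead_coef p)^-1%:P%:P * (lead_coef p)%:P%:P = 1 :> {poly {poly k}}.
    by rewrite -!polyCM mulVf ?lead_coef_eq0.
  by rewrite -[LHS]mul1r -E; ring.
exact: in_idealM.
Qed.
End Closed.

(** * Points of [X] on a line *)

Section Lines.
Variable k : closedFieldType.
Implicit Types (f g h p t : {poly {poly k}}) (z : k * k) (X : seq (k * k)).

Lemma coef_horner_swap f x j : f.[x%:P]`_j = ((swapXY f)`_j).[x].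
Proof. by rewrite -{1}[f]swapXYK horner_swapXY coef_map. Qed.

Lemma size_horner_bounded i j f x : bounded i j f -> (size (f.[x%:P])%R <= j)%N.
Proof.
move=> Hf; apply/leq_sizeP => s js; rewrite coef_horner_swap.
rewrite (_ : (swapXY f)`_s = 0) ?horner0 //; apply/polyP => r.
by rewrite coef_swapXY Hf ?coef0 // js orbT.
Qed.

Lemma tame_sym a b c d f g : tame a b c d f g -> tame c d a b g f.
Proof.
by case=> Hf Hg H1 H2 H3; split; rewrite // 1?coprimep_sym 1?orbC.
Qed.

Lemma in_ideal_sym f g h : in_ideal f g h -> in_ideal g f h.
Proof. by move=> [u [v ->]]; exists v, u; rewrite addrC. Qed.

Definition on_line x : pred (k * k) := fun z => z.1 == x.

Definition ys X x := [seq z.2 | z <- X & on_line x z].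

Lemma size_ys X x : size (ys X x) = count (on_line x) X.
Proof. by rewrite size_map size_filter. Qed.

Lemma uniq_ys X x : uniq X -> uniq (ys X x).
Proof.
move=> uX; rewrite map_inj_in_uniq ?filter_uniq // => -[a b] [a' b'].
by rewrite !mem_filter /on_line /= => /andP[/eqP-> _] /andP[/eqP-> _] ->.
Qed.

(** The restriction of [f] to the line is a nonzero polynomial of degree at most [j], with the
    points of [X] on the line as distinct roots. *)
Lemma line_bound i j f X x : bounded i j.+1 f -> uniq X -> vanish X f ->
  f.[x%:P] != 0 -> (count (on_line x) X <= j)%N.
Proof.
move=> Hf uX Vf fx; rewrite -size_ys -ltnS.
apply: leq_trans (size_horner_bounded x Hf).
apply: max_poly_roots fx _ (uniq_ys x uX); apply/allP => y /mapP[[z1 z2]].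
by rewrite mem_filter => /andP[/eqP /= <- /Vf] + -> /=; rewrite rootE => <-.
Qed.

(** As [f] vanishes on the line, the ideal restricts to the multiples of the restriction of [g]. The
    latter has degree exactly [d], because [f] and [g] have no common zero at y = infinity. It
    vanishes at the points on the line and divides the product of their linear factors. *)
Lemma line_count a b c d f g X x :
  tame a b c d f g -> uniq X -> (forall h, vanish X h <-> in_ideal f g h) ->
  f.[x%:P] = 0 -> count (on_line x) X = d.
Proof.
move=> T uX HX fx; have [Hf Hg _ cop _] := T.
have gd : g.[x%:P]`_d != 0.
  rewrite coef_horner_swap; apply: coprimep_root cop _.
  by rewrite rootE -coef_horner_swap fx coef0.
have g0 : g.[x%:P] != 0 by apply: contraNneq gd => ->; rewrite coef0.
apply/eqP; rewrite eqn_leq (line_bound Hg uX _ g0) /=; last first.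
  by apply/HX; exists 0, 1; rewrite mul0r mul1r add0r.
(* The first factor kills the points on the line; the second kills the others and is a nonzero
   constant on the line. *)
pose h := \prod_(y <- ys X x) ('X - y%:P)%:P
          * \prod_(z <- X | z.1 != x) ('X - z.1%:P%:P) : {poly {poly k}}.
have [u [v /(congr1 (fun h => h.[x%:P]))]] : in_ideal f g h.
  apply/HX => z zX; rewrite evM !ev_prod; apply/eqP; rewrite mulf_eq0 !prodf_seq_eq0.
  have [zx|zx] := eqVneq z.1 x.
    apply/orP; left; apply/hasP; exists z.2; last by rewrite /= ev_y subrr.
    by apply: map_f; rewrite mem_filter /on_line zx eqxx.
  by apply/orP; right; apply/hasP; exists z; rewrite // zx /= ev_x subrr.
rewrite !hornerE fx mulr0 add0r !horner_prod.
under eq_bigr do rewrite hornerC.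
have -> : \prod_(z <- X | z.1 != x) ('X - z.1%:P%:P).[x%:P]
          = (\prod_(z <- X | z.1 != x) (x - z.1))%:P.
  by rewrite rmorph_prod /=; apply: eq_bigr => z _; rewrite !hornerE polyCB.
set c0 := \prod_(z <- X | _) _; have c00 : c0 != 0.
  rewrite prodf_seq_neq0; apply/allP => z _; apply/implyP.
  by rewrite subr_eq0 eq_sym.
rewrite mulrC mul_polyC => E.
have : g.[x%:P] %| c0 *: \prod_(y <- ys X x) ('X - y%:P) by rewrite E dvdp_mull.
rewrite dvdpZr // => /dvdp_leq; rewrite -size_poly_eq0 size_prod_XsubC => /(_ isT).
rewrite size_ys => le; rewrite -ltnS; apply: leq_trans le.
by rewrite ltnNge; apply: contra gd => /leq_sizeP->.
Qed.

Lemma gcd_dvd_card a b c d f g X m n x y :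
  tame a b c d f g -> uniq X -> (forall h, vanish X h <-> in_ideal f g h) ->
  count (fun z => z.2 == y) X = m -> count (fun z => z.1 == x) X = n ->
  (size X < m * n)%N -> (gcdn m n %| size X)%N.
Proof.
move=> T uX HX Em En.
pose X' := [seq (z.2, z.1) | z <- X].
have uX' : uniq X' by rewrite map_inj_uniq // => -[? ?] [? ?] [-> ->].
have HX' h : vanish X' h <-> in_ideal (swapXY f) (swapXY g) h.
  rewrite -[in in_ideal _ _ h](swapXYK h) in_ideal_swap -HX.
  split=> V z; first by move=> zX; rewrite ev_swap; apply: V; apply: map_f zX.
  by case/mapP=> w wX ->; rewrite -ev_swap; apply: V.
have Em' : count (on_line y) X' = m by rewrite count_map -Em.
have inf : in_ideal f g f by exists 1, 0; rewrite mul1r mul0r addr0.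
have ing : in_ideal f g g by exists 0, 1; rewrite mul1r mul0r add0r.
have [Hf Hg _ _ _] := T; have T' := tame_swap T; have [Hf' Hg' _ _ _] := T'.
have HXs h : vanish X h <-> in_ideal g f h.
  by rewrite HX; split; apply: in_ideal_sym.
have HXs' h : vanish X' h <-> in_ideal (swapXY g) (swapXY f) h.
  by rewrite HX'; split; apply: in_ideal_sym.
rewrite (card_of_ideal T uX HX) => lt.
have Bf : (swapXY f).[y%:P] != 0 -> (m <= a)%N.
  by rewrite -Em'; apply: (line_bound Hf') => //; apply/HX'/in_ideal_swap.
have Bg : (swapXY g).[y%:P] != 0 -> (m <= c)%N.
  by rewrite -Em'; apply: (line_bound Hg') => //; apply/HX'/in_ideal_swap.
(* If [f] vanishes on the vertical line, then [n = d]. Were it nonzero on the horizontal one,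
   [m <= a] would give [m n <= a d]. Hence [m = c], and [a d + b c = a n + b m]. *)
have [fx|fx] := eqVneq f.[x%:P] 0.
  have En' := line_count T uX HX fx; move: lt; rewrite -En' [count _ _]En.
  have [fy|/Bf ma] := eqVneq (swapXY f).[y%:P] 0; last first.
    by rewrite ltnNge (leq_trans (leq_mul ma (leqnn n)) (leq_addr _ _)).
  rewrite -(line_count T' uX' HX' fy) Em' => _.
  by rewrite dvdn_add // ?dvdn_mull ?dvdn_gcdl ?dvdn_gcdr.
have {fx}nb : (n <= b)%N by rewrite -En; apply: (line_bound Hf uX _ fx); apply/HX.
(* The same with [f] and [g] exchanged, ending in [n = b] and [m = a]. *)
have [gx|gx] := eqVneq g.[x%:P] 0.
  have En' := line_count (tame_sym T) uX HXs gx; move: lt; rewrite -En' [count _ _]En.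
  have [gy|/Bg mc] := eqVneq (swapXY g).[y%:P] 0; last first.
    by rewrite ltnNge mulnC (leq_trans (leq_mul (leqnn n) mc) (leq_addl _ _)).
  rewrite -(line_count (tame_sym T') uX' HXs' gy) Em' => _.
  by rewrite dvdn_add // dvdn_mulr ?dvdn_gcdl ?dvdn_gcdr.
(* Neither form vanishes on the vertical line, so [n] is at most both [b] and [d]; now [m = c] and
   [m <= a] each contradict the bound on [size X]. *)
have {gx}nd : (n <= d)%N by rewrite -En; apply: (line_bound Hg uX _ gx); apply/HX.
move: lt; have [fy|/Bf ma] := eqVneq (swapXY f).[y%:P] 0; rewrite ltnNge.
  rewrite -(line_count T' uX' HX' fy) Em' mulnC.
  by rewrite (leq_trans (leq_mul nb (leqnn m)) (leq_addl _ _)).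
by rewrite (leq_trans (leq_mul ma nd) (leq_addr _ _)).
Qed.
End Lines.

(** * Bihomogeneous forms and points *)

Section Forms.
Variable k : closedFieldType.
Implicit Types (f g h s t : cox k) (d : int * int) (z : P1xP1 k) (v w : 'rV[k]_2).

Lemma bihomogP d f :
  reflect (forall e, f@_e != 0 -> mbideg e = d) (bihomog d f).
Proof.
apply: (iffP allP) => H e; first by rewrite -mcoeff_msupp => /H/eqP.
by rewrite mcoeff_msupp => /H->.
Qed.

Lemma mbidegD e e' : mbideg (e + e')%MM = mbideg e + mbideg e'.
Proof.
by rewrite /mbideg; congr pair;
  rewrite -PoszD -big_split; congr Posz; apply: eq_bigr => i _; rewrite mnmDE.
Qed.

Lemma bihomog0 d : bihomog d (0 : cox k).
Proof. by apply/bihomogP => e; rewrite mcoeff0 eqxx. Qed.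

Lemma bihomogD d f g : bihomog d f -> bihomog d g -> bihomog d (f + g).
Proof.
move=> /allP Hf /allP Hg; apply/allP => e /msuppD_le.
by rewrite mem_cat => /orP[/Hf | /Hg].
Qed.

Lemma bihomogM d d' f g : bihomog d f -> bihomog d' g -> bihomog (d + d') (f * g).
Proof.
move=> /allP Hf /allP Hg; apply/allP => e /msuppM_le /allpairsP[[e1 e2] /= [h1 h2 ->]].
by rewrite mbidegD (eqP (Hf _ h1)) (eqP (Hg _ h2)).
Qed.

Lemma bihomogC (c : k) : bihomog 0 c%:MP_[2 + 2].
Proof.
apply/bihomogP => e; rewrite mcoeffC.
case: (e =P 0%MM) => [->|_]; last by rewrite mulr0 eqxx.
by rewrite /mbideg !big1 // => i _; rewrite mnm0E.
Qed.

Lemma bihomog1 : bihomog 0 (1 : cox k).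
Proof. by rewrite -mpolyC1; apply: bihomogC. Qed.

Lemma bihomogX d f n : bihomog d f -> bihomog (d *+ n) (f ^+ n).
Proof.
move=> Hf; elim: n => [|n IH]; first exact: bihomog1.
by rewrite exprS mulrS; apply: bihomogM.
Qed.

Lemma bihomog_xvar i : bihomog (1, 0) (xvar k i).
Proof.
apply/bihomogP => e; rewrite mcoeffX; case: (_ =P e) => [<- _|_]; last by rewrite eqxx.
rewrite /mbideg; congr (Posz _, Posz _).
  rewrite (bigD1 i) //= mnm1E eqxx big1 // => j ji; rewrite mnm1E.
  by rewrite (inj_eq (@lshift_inj _ _)) eq_sym (negPf ji).
by rewrite big1 // => j _; rewrite mnm1E eq_lrshift.
Qed.

Lemma bihomog_yvar i : bihomog (0, 1) (yvar k i).
Proof.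
apply/bihomogP => e; rewrite mcoeffX; case: (_ =P e) => [<- _|_]; last by rewrite eqxx.
rewrite /mbideg; congr (Posz _, Posz _).
  by rewrite big1 // => j _; rewrite mnm1E eq_rlshift.
rewrite (bigD1 i) //= mnm1E eqxx big1 // => j ji; rewrite mnm1E.
by rewrite (inj_eq (@rshift_inj _ _)) eq_sym (negPf ji).
Qed.

Lemma bihomog_natdeg d f : bihomog d f -> f != 0 -> exists a b : nat, d = (a%:Z, b%:Z).
Proof.
rewrite -msupp_eq0; case E: (msupp f) => [|e l] // /allP/(_ e) + _.
by rewrite E mem_head => /(_ isT)/eqP<-; eexists; eexists.
Qed.

(** The absolute values turn integer degrees into exponents: monomials have nonnegative degrees, and
    for [f = 0] both sides are 0. *)
Lemma meval_bihomog d f (l m : k) v w : bihomog d f ->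
  f.@[row_mx (l *: v) (m *: w) 0]
  = l ^+ `|d.1|%N * m ^+ `|d.2|%N * f.@[row_mx v w 0].
Proof.
move=> Hf; rewrite !mevalE mulr_sumr; apply: eq_big_seq => e.
move/(allP Hf) => /eqP<- /=; rewrite mulrCA; congr (_ * _).
rewrite !big_split_ord /=.
under eq_bigr do rewrite row_mxEl mxE exprMn.
under [X in _ * X = _]eq_bigr do rewrite row_mxEr mxE exprMn.
rewrite !big_split /= !prodrXr mulrACA; congr (_ * (_ * _));
  by apply: eq_bigr => i _; rewrite ?row_mxEl ?row_mxEr.
Qed.

Definition frame z v w := <[v]>%VS = val z.1 /\ <[w]>%VS = val z.2.

Lemma frame_neq0 z v w : frame z v w -> v != 0 /\ w != 0.
Proof.
case: z => -[l Hl] [l' Hl'] [/= E1 E2]; move: Hl Hl'; rewrite -E1 -E2 !dim_vline.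
by case: (v != 0) (w != 0) => -[].
Qed.

Lemma frame_exists z : exists v w, frame z v w.
Proof.
have H (l : P1 k) : exists v, <[v]>%VS = val l.
  case: l => l Hl /=; exists (vpick l); apply/eqP.
  rewrite eqEdim -memvE memv_pick dim_vline vpick0.
  by rewrite (eqP Hl); case: (l =P 0%VS) Hl => [->|]; rewrite ?dimv0.
by have [v Ev] := H z.1; have [w Ew] := H z.2; exists v, w.
Qed.

Lemma vanishesP d f z v w : bihomog d f -> frame z v w ->
  vanishes f z <-> f.@[row_mx v w 0] = 0.
Proof.
move=> Hf [Ev Ew]; split=> [H|H v' w' Ev' Ew']; first exact: H.
have /vlineP[l ->] : v' \in <[v]>%VS by rewrite Ev -Ev' memv_line.
have /vlineP[m ->] : w' \in <[w]>%VS by rewrite Ew -Ew' memv_line.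
by rewrite (meval_bihomog _ _ _ _ Hf) H mulr0.
Qed.

Lemma nvanishesM d d' s t z : bihomog d s -> bihomog d' t ->
  ~ vanishes s z -> ~ vanishes t z -> ~ vanishes (s * t) z.
Proof.
move=> Hs Ht; have [v [w F]] := frame_exists z.
rewrite (vanishesP Hs F) (vanishesP Ht F) (vanishesP (bihomogM Hs Ht) F) mevalM.
by move=> /eqP s0 /eqP t0; apply/eqP; rewrite mulf_neq0.
Qed.

Lemma nvanishes1 z : ~ vanishes (1 : cox k) z.
Proof.
have [v [w F]] := frame_exists z; rewrite (vanishesP bihomog1 F) meval1.
by apply/eqP; rewrite oner_neq0.
Qed.

(** A monomial in coordinates that are nonzero at [z] works. It serves as denominator for a form of
    the same bidegree. *)
Lemma form_neq0_at z (a b : nat) : exists2 s, bihomog (a%:Z, b%:Z) s & ~ vanishes s z.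
Proof.
have [v [w F]] := frame_exists z; have [v0 w0] := frame_neq0 F.
have [i vi] : exists i, v 0 i != 0 by apply/rV0Pn.
have [j wj] : exists j, w 0 j != 0 by apply/rV0Pn.
have Hs : bihomog (a%:Z, b%:Z) (xvar k i ^+ a * yvar k j ^+ b).
  have -> : (a%:Z, b%:Z) = ((1, 0) : int * int) *+ a + ((0, 1) : int * int) *+ b.
    by rewrite !pairMnE /= !mul0rn !pmulrn; congr pair => /=; lia.
  by apply: bihomogM; apply: bihomogX; [apply: bihomog_xvar | apply: bihomog_yvar].
exists (xvar k i ^+ a * yvar k j ^+ b); rewrite // (vanishesP Hs F).
rewrite mevalM !rmorphXn /= !mevalXU row_mxEl row_mxEr.
by apply/eqP; rewrite mulf_neq0 ?expf_neq0.
Qed.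
End Forms.

(** * Local comparison of the ideals *)

Section Stalks.
Variable k : closedFieldType.
Implicit Types (f g h s t : cox k) (d : int * int) (z : P1xP1 k).
Implicit Types (U : P1xP1 k -> Prop).

Definition rel_submodule (M : gmodule k) :=
  [/\ @gm_rel k M 0, forall v w, @gm_rel k M v -> gm_rel w -> gm_rel (v + w)
    & forall s v, @gm_rel k M v -> gm_rel (s *: v)].

Section Module.
Variable M : gmodule k.
Hypothesis subM : rel_submodule M.
Implicit Types (a b c : fraction M) (v : 'rV[cox k]_(gm_rank M)).

Let rel0 : @gm_rel k M 0. Proof. by case: subM. Qed.
Let relD v w : @gm_rel k M v -> gm_rel w -> gm_rel (v + w).
Proof. by case: subM => _ + _; apply. Qed.
Let relZ s v : @gm_rel k M v -> gm_rel (s *: v).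
Proof. by case: subM => _ _; apply. Qed.

Lemma stalk_eq_of_rel z a b : gm_rel (b.2 *: a.1 - a.2 *: b.1) -> stalk_eq z a b.
Proof.
by exists 0, 1; split; rewrite ?scale1r //; [apply: bihomog1 | apply: nvanishes1].
Qed.

Lemma stalk_eq_refl z a : stalk_eq z a a.
Proof. by apply: stalk_eq_of_rel; rewrite subrr. Qed.

Lemma stalk_eq_sym z a b : stalk_eq z a b -> stalk_eq z b a.
Proof.
case=> d [t [Ht tz R]]; exists d, t; split=> //.
by rewrite -opprB scalerN -scaleN1r; apply: relZ.
Qed.

(** The witness [t * (t' * b.2)] contains the denominator of the middle fraction, which must
    therefore not vanish at [z]. *)
Lemma stalk_eq_trans z a b c :
  in_stalk z b -> stalk_eq z a b -> stalk_eq z b c -> stalk_eq z a c.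
Proof.
case=> e [_ Hb bz] [d [t [Ht tz R]]] [d' [t' [Ht' tz' R']]].
exists (d + (d' + e)), (t * (t' * b.2)); split.
- by do ![apply: bihomogM => //].
- by apply: (nvanishesM Ht (bihomogM Ht' Hb)) => //; apply: (nvanishesM Ht' Hb).
have -> : t * (t' * b.2) *: (c.2 *: a.1 - a.2 *: c.1)
  = (t' * c.2) *: (t *: (b.2 *: a.1 - a.2 *: b.1))
    + (t * a.2) *: (t' *: (c.2 *: b.1 - b.2 *: c.1)).
  by apply/rowP => i; rewrite !mxE; ring.
by apply: relD; apply: relZ.
Qed.

Definition rfrac h s : fraction (ring_module k) := (const_mx h, s).

Lemma fscale_stalk_eq z h s a b :
  stalk_eq z a b -> stalk_eq z (fscale (rfrac h s) a) (fscale (rfrac h s) b).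
Proof.
case=> d [t [Ht tz R]]; exists d, t; split=> //=; rewrite !mxE.
have -> : t *: ((s * b.2) *: (h *: a.1) - (s * a.2) *: (h *: b.1))
          = (s * h) *: (t *: (b.2 *: a.1 - a.2 *: b.1)).
  by apply/rowP => i; rewrite !mxE; ring.
exact: relZ.
Qed.

Lemma fscale_in_stalk d z h s a : bihomog d h -> bihomog d s -> ~ vanishes s z ->
  in_stalk z a -> in_stalk z (fscale (rfrac h s) a).
Proof.
move=> Hh Hs sz [e [Ha1 Ha2 az]]; exists (d + e); split=> /=.
- by move=> j; rewrite !mxE -addrA; apply: bihomogM.
- exact: bihomogM.
- exact: nvanishesM Hs Ha2 sz az.
Qed.

Lemma section_in_stalk U (a : P1xP1 k -> fraction M) z :
  is_section U a -> U z -> in_stalk z (a z).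
Proof. by move=> Sa /Sa[V [b [_ Vz _ H]]]; case: (H _ Vz). Qed.

Lemma const_section U a : zariski_open U -> (forall z, U z -> in_stalk z a) ->
  is_section U (fun=> a).
Proof.
move=> oU Ha z Uz; exists U, a; split=> // w Uw.
by split; [apply: Ha | apply: Ha | apply: stalk_eq_refl].
Qed.

Lemma fscale_section U d h s (a : P1xP1 k -> fraction M) :
  bihomog d h -> bihomog d s -> (forall z, U z -> ~ vanishes s z) ->
  is_section U a -> is_section U (fun z => fscale (rfrac h s) (a z)).
Proof.
move=> Hh Hs sU Sa z Uz; have [V [b [oV Vz VU H]]] := Sa z Uz.
exists V, (fscale (rfrac h s) b); split=> // w Vw; have [H1 H2 H3] := H w Vw.
split; last exact: fscale_stalk_eq.
  by apply: fscale_in_stalk Hh Hs _ H1; apply: sU; apply: VU.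
by apply: fscale_in_stalk Hh Hs _ H2; apply: sU; apply: VU.
Qed.

(** Zero keeps the form [0 / s], so that [iso_scale] applies to both sides alike. *)
Lemma fscale_killed z h s a : (forall v, @gm_rel k M (h *: v)) ->
  stalk_eq z (fscale (rfrac h s) a) (fscale (rfrac 0 s) a).
Proof.
move=> Mh; apply: stalk_eq_of_rel; rewrite /= !mxE scale0r scaler0 subr0.
by rewrite scalerA mulrC -scalerA.
Qed.

End Module.

Lemma ring_submodule : rel_submodule (ring_module k).
Proof.
split=> /= [|v w|s v]; rewrite ?mxE //; first by move=> -> ->; rewrite addr0.
by move=> ->; rewrite mulr0.
Qed.

Lemma nonvanishing_open d s : bihomog d s -> zariski_open (fun z => ~ vanishes s z).
Proof.
move=> Hs; exists (eq s); split=> [f <-|z]; first by exists d.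
by split=> [|[f <-]//]; exists s.
Qed.

Lemma rfrac_section d h s : bihomog d h -> bihomog d s ->
  is_section (fun z => ~ vanishes s z) (fun=> rfrac h s).
Proof.
move=> Hh Hs; apply: const_section (nonvanishing_open Hs) _.
  exact: ring_submodule.
by move=> z sz; exists d; split=> // j; rewrite mxE subr0.
Qed.

Section Iso.
Variables (M N : gmodule k).
Hypotheses (subM : rel_submodule M) (subN : rel_submodule N).
Variable phi : (P1xP1 k -> Prop) -> (P1xP1 k -> fraction M) -> (P1xP1 k -> fraction N).
Hypothesis iso : is_sheaf_iso phi.

(* A section [b] of N is the image of some [a], on which h / s acts as 0. *)
Lemma iso_killed d h s z (b : fraction N) :
  (forall w, in_stalk w b) -> (forall v, @gm_rel k M (h *: v)) ->
  bihomog d h -> bihomog d s -> ~ vanishes s z ->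
  exists d' t, [/\ bihomog d' t, ~ vanishes t z & @gm_rel k N (t *: (h *: b.1))].
Proof.
move=> Hb Mh Hh Hs sz; pose U w := ~ vanishes s w.
have oU : zariski_open U := nonvanishing_open Hs.
have U0 := bihomog0 k d.
have [a Sa Ea] := iso_surj iso oU (const_section subN oU (fun w _ => Hb w)).
have Spa := iso_section iso oU Sa.
have Shs h' (Hh' : bihomog d h') :=
  fscale_section subM Hh' Hs (fun w (Uw : U w) => Uw) Sa.
have sc h' (Hh' : bihomog d h') := iso_scale iso oU (rfrac_section Hh' Hs) Sa sz.
have eq1 : stalk_eq z (fscale (rfrac h s) b) (fscale (rfrac h s) (phi U a z)).
  exact/(fscale_stalk_eq subN)/(stalk_eq_sym subN)/Ea.
have eq2 := stalk_eq_sym subN (sc _ Hh).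
have eq3 := iso_eq iso oU (Shs _ Hh) (Shs _ U0)
  (fun w _ => fscale_killed w s (a w) Mh) sz.
have eq4 := sc _ U0.
have st h' (Hh' : bihomog d h') := section_in_stalk (iso_section iso oU (Shs _ Hh')) sz.
have pst := section_in_stalk Spa sz.
(* In the stalk at [z], the chain is [(h / s) b = (h / s) phi(a) = phi((h / s) a) = phi((0 / s) a) =
   (0 / s) phi(a)]. *)
have := stalk_eq_trans subN (fscale_in_stalk Hh Hs sz pst) eq1
  (stalk_eq_trans subN (st _ Hh) eq2 (stalk_eq_trans subN (st _ U0) eq3 eq4)).
case=> d' [t [Ht tz]] /=; rewrite !mxE scale0r scaler0 subr0 !scalerA => R.
have [e [_ He ez]] := pst.
exists (d' + (d + e)), (t * (s * (phi U a z).2)); split.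
- by do ![apply: bihomogM => //].
- by apply: (nvanishesM Ht (bihomogM Hs He)) => //; apply: (nvanishesM Hs He).
- by rewrite scalerA -!mulrA in R *.
Qed.

(** Because [h] kills [N], [phi] sends [(h / s) a] and [(0 / s) a] to equal sections, and
    injectivity pulls the equality back. *)
Lemma iso_killed_inv d h s z (a : fraction M) :
  (forall w, in_stalk w a) -> (forall v, @gm_rel k N (h *: v)) ->
  bihomog d h -> bihomog d s -> ~ vanishes s z ->
  exists d' t, [/\ bihomog d' t, ~ vanishes t z & @gm_rel k M (t *: (h *: a.1))].
Proof.
move=> Ha Nh Hh Hs sz; pose U w := ~ vanishes s w.
have oU : zariski_open U := nonvanishing_open Hs.
have U0 := bihomog0 k d.
have Sa := const_section subM oU (fun w _ => Ha w).
have Spa := iso_section iso oU Sa.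
have Shs h' (Hh' : bihomog d h') :=
  fscale_section subM Hh' Hs (fun w (Uw : U w) => Uw) Sa.
have sc h' (Hh' : bihomog d h') := iso_scale iso oU (rfrac_section Hh' Hs) Sa.
have eqU : section_eq U (phi U (fun=> fscale (rfrac h s) a))
                        (phi U (fun=> fscale (rfrac 0 s) a)).
  move=> w sw; have pst := section_in_stalk Spa sw.
  apply: (stalk_eq_trans subN _ (sc _ Hh w sw)).
    exact: fscale_in_stalk Hh Hs sw pst.
  apply: (stalk_eq_trans subN _ (fscale_killed w s _ Nh)).
    exact: fscale_in_stalk U0 Hs sw pst.
  exact: (stalk_eq_sym subN (sc _ U0 w sw)).
have [d' [t [Ht tz]]] := iso_inj iso oU (Shs _ Hh) (Shs _ U0) eqU sz.
rewrite /= !mxE scale0r scaler0 subr0 !scalerA => R.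
have [e [_ He ez]] := Ha z.
exists (d' + (d + e)), (t * (s * a.2)); split.
- by do ![apply: bihomogM => //].
- by apply: (nvanishesM Ht (bihomogM Hs He)) => //; apply: (nvanishesM Hs He).
- by rewrite scalerA -!mulrA in R *.
Qed.
End Iso.
End Stalks.

Section Koszul.
Variable k : closedFieldType.
Implicit Types (f g h s t : cox k) (d : int * int) (z : P1xP1 k).

Lemma vanishing_submodule X : rel_submodule (cyclic_module (@vanishing_ideal k X)).
Proof.
split=> /= [z _ v w _ _|v w Hv Hw z zX|s v Hv z zX] /=.
- by rewrite mxE meval0.
- move=> v' w' E1 E2.
  by rewrite mxE mevalD (Hv _ zX _ _ E1 E2) (Hw _ zX _ _ E1 E2) addr0.
- by move=> v' w' E1 E2; rewrite mxE mevalM (Hv _ zX _ _ E1 E2) mulr0.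
Qed.

Lemma koszul_relP (df dg : int * int) f g (v : 'rV_1) :
  @gm_rel k (coker1 (koszul df dg f g)) v <-> exists u w, v 0 0 = u * f + w * g.
Proof.
split=> [[y ->]|[u [w E]]].
  exists (y 0 0), (y 0 (lift ord0 ord0)).
  by rewrite /= mxE !big_ord_recl big_ord0 addr0 !mxE.
exists (\row_j (if j == 0 :> nat then u else w)); apply/rowP => i.
by rewrite ord1 mxE /= E !big_ord_recl big_ord0 addr0 !mxE.
Qed.

Lemma koszul_submodule (df dg : int * int) f g :
  rel_submodule (coker1 (koszul df dg f g)).
Proof.
split=> [|v w|s v]; rewrite !koszul_relP ?mxE.
- by exists 0, 0; rewrite !mul0r addr0.
- by move=> [u1 [w1 ->]] [u2 [w2 ->]]; exists (u1 + u2), (w1 + w2); ring.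
- by move=> [u1 [w1 ->]]; exists (s * u1), (s * w1); ring.
Qed.

Lemma in_stalk1 (M : gmodule k) z (v : 'rV_(gm_rank M)) : gm_homog 0 v ->
  @in_stalk k M z (v, 1).
Proof. by move=> Hv; exists 0; split=> //; [apply: bihomog1 | apply: nvanishes1]. Qed.

(** The form [h] annihilates S/I_X, hence by [iso_killed] it annihilates the generator 1 of S/(f, g)
    locally at [z]. *)
Lemma koszul_local X (df dg : int * int) f g (a b : nat) z h :
  sheaf_isomorphic (cyclic_module (@vanishing_ideal k X)) (coker1 (koszul df dg f g)) ->
  vanishing_ideal X h -> bihomog (a%:Z, b%:Z) h ->
  exists d t u w, [/\ bihomog d t, ~ vanishes t z & t * h = u * f + w * g].
Proof.
move=> [phi iso] Xh Hh; have [s Hs sz] := form_neq0_at z a b.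
have [|v|d [t [Ht tz]]] := iso_killed (vanishing_submodule X)
  (koszul_submodule df dg f g) iso (b := (const_mx 1, 1)) _ _ Hh Hs sz.
- by move=> w; apply: in_stalk1 => j; rewrite mxE; apply: bihomog1.
- by move=> w wX v' w' E1 E2; rewrite mxE mevalM (Xh _ wX _ _ E1 E2) mul0r.
by rewrite koszul_relP !mxE mulr1 => -[u [w E]]; exists d, t, u, w.
Qed.

(** Now [h] annihilates S/(f, g), so at a point [z] of [X] some [t * h] with [t] nonzero at [z] lies
    in I_X, and [h] vanishes at [z]. *)
Lemma koszul_vanishing X (df dg : int * int) f g d h :
  sheaf_isomorphic (cyclic_module (@vanishing_ideal k X)) (coker1 (koszul df dg f g)) ->
  (exists u w, h = u * f + w * g) -> bihomog d h -> vanishing_ideal X h.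
Proof.
move=> [phi iso] [u [w Eh]] Hh z zX.
have [->|h0] := eqVneq h 0; first by move=> ? ? _ _; rewrite meval0.
have [a [b Ed]] := bihomog_natdeg Hh h0; rewrite {}Ed in Hh.
have [s Hs sz] := form_neq0_at z a b.
have [||d' [t [Ht tz]]] := iso_killed_inv (vanishing_submodule X)
  (koszul_submodule df dg f g) iso (a := (const_mx 1, 1)) _ _ Hh Hs sz.
- by move=> z'; apply: in_stalk1 => j; rewrite mxE; apply: bihomog1.
- move=> v; rewrite koszul_relP mxE Eh; exists (u * v 0 0), (w * v 0 0); ring.
move=> /(_ z zX) /=; rewrite !mxE mulr1; have [v0 [w0 F]] := frame_exists z.
rewrite (vanishesP (bihomogM Ht Hh) F) (vanishesP Hh F) mevalM => /eqP.
by rewrite mulf_eq0 => /orP[/eqP/(vanishesP Ht F)|/eqP].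
Qed.
End Koszul.

(** * Affine coordinates *)

Section Chart.
Variable k : closedFieldType.

Section OneFactor.
Variable s : k.
Implicit Types (o : option k) (n : nat) (p q : {poly k}) (l : P1 k).

(* [None] is the point at infinity (s : 1) of the chart x |-> (1 + s x : x); varying s
   moves it away from any finite set. *)
Definition pt_vec o : 'rV[k]_2 :=
  if o is Some x then \row_j (if j == 0 then 1 + s * x else x)
  else \row_j (if j == 0 then s else 1).

Arguments pt_vec : simpl never.

Lemma pt_vec_neq0 o : pt_vec o != 0.
Proof.
apply/eqP => E; have := congr1 (fun v : 'rV_2 => v 0 1) E.
case: o E => [x|] /= E; rewrite !mxE /= => E1; last by move/eqP: E1; rewrite oner_eq0.
have := congr1 (fun v : 'rV_2 => v 0 0) E; rewrite !mxE /= E1 mulr0 addr0 => /eqP.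
by rewrite oner_eq0.
Qed.

Fact pt_subproof o : \dim <[pt_vec o]> == 1%N.
Proof. by rewrite dim_vline pt_vec_neq0. Qed.

Definition pt o : P1 k := Sub <[pt_vec o]>%VS (pt_subproof o).

(** Inverse of the parametrization: on the vector [c (1 + s x, x)] the denominator is the scale
    [c]. *)
Definition chart l : k := let v := vpick (val l) in v 0 1 / (v 0 0 - s * v 0 1).

Lemma row2P (v w : 'rV[k]_2) : v 0 0 = w 0 0 -> v 0 1 = w 0 1 -> v = w.
Proof.
move=> E0 E1; apply/rowP => i.
have [->|->] // : i = 0 \/ i = 1.
by case: i => -[|[|i]] // Hi; [left | right]; apply/val_inj.
Qed.

Lemma P1_span l v : v \in val l -> v != 0 -> val l = <[v]>%VS.
Proof.
move=> vl v0; apply/esym/eqP; rewrite eqEdim -memvE vl dim_vline v0 /=.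
by case: l {vl} => l /= /eqP->.
Qed.

Lemma chartK l : l != pt None -> pt (Some (chart l)) = l.
Proof.
move=> ninf; apply/val_inj => /=; pose v := vpick (val l).
have v0 : v != 0.
  rewrite vpick0; apply/eqP => E; case: l @v ninf E => l Hl /= _ E0.
  by rewrite E0 dimv0 in Hl.
have vl : v \in val l := memv_pick _.
have d0 : v 0 0 - s * v 0 1 != 0.
  apply: contraNneq ninf => /eqP; rewrite subr_eq0 => /eqP E.
  have Ev : v = v 0 1 *: pt_vec None by apply: row2P; rewrite !mxE /= ?mulr1 // mulrC.
  apply/eqP/val_inj; apply: P1_span; rewrite ?pt_vec_neq0 //.
  have v1 : v 0 1 != 0 by apply: contraNneq v0 => E1; rewrite Ev E1 scale0r.
  by rewrite -[pt_vec None](scalerK v1) -Ev memvZ.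
apply/esym/P1_span; rewrite ?pt_vec_neq0 //.
have -> : pt_vec (Some (chart l)) = (v 0 0 - s * v 0 1)^-1 *: v.
  by apply: row2P; rewrite !mxE /= /chart -/v; field.
exact: memvZ.
Qed.

(* The value at a point of P^1 of the binary form of degree n that dehomogenizes
   to p. *)
Definition pt_eval n o p := if o is Some x then p.[x] else p`_n.

(** The two coordinates of the parametrization, to be substituted for the homogeneous variables. *)
Definition lin (j : 'I_2) : {poly k} := if j == 0 then 1 + s *: 'X else 'X.

Lemma size_lin j : (size (lin j) <= 2)%N.
Proof.
rewrite /lin; case: ifP => _; last by rewrite size_polyX.
rewrite (leq_trans (size_polyD _ _)) // size_poly1 geq_max.
by rewrite (leq_trans (size_scale_leq _ _)) ?size_polyX.
Qed.

Lemma pt_evalM n m o p q : (size p <= n.+1)%N -> (size q <= m.+1)%N ->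
  pt_eval (n + m) o (p * q) = pt_eval n o p * pt_eval m o q.
Proof.
case: o => [x|] Hp Hq /=; first by rewrite hornerM.
by rewrite (@coefM_top _ _ m) ?leq_addl ?addnK // -addSn addnK.
Qed.

Lemma size_lin_exp j n : (size (lin j ^+ n) <= n.+1)%N.
Proof.
apply: leq_trans (size_poly_exp_leq _ _) _; have := size_lin j.
by case: (size _) => [|[|[|]]] //= _; rewrite ?mul0n ?mul1n.
Qed.

Lemma pt_eval_lin o j : pt_eval 1 o (lin j) = pt_vec o 0 j.
Proof.
case: o => [x|]; rewrite /= /lin mxE; case: ifP => _.
- by rewrite !hornerE.
- by rewrite hornerX.
- by rewrite coefD coef1 coefZ coefX mulr1 add0r.
- by rewrite coefX.
Qed.

Lemma pt_eval_lin_exp o j n : pt_eval n o (lin j ^+ n) = pt_vec o 0 j ^+ n.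
Proof.
elim: n => [|n IH]; first by case: o => [x|]; rewrite /= ?hornerE ?coef1.
by rewrite !exprS -add1n pt_evalM ?size_lin ?size_lin_exp // IH pt_eval_lin.
Qed.

Definition lin_monom (e : 'I_2 -> nat) : {poly k} := \prod_j lin j ^+ e j.

Lemma lin_monomE e : lin_monom e = lin 0 ^+ e 0 * lin 1 ^+ e 1.
Proof.
rewrite /lin_monom !big_ord_recl big_ord0 mulr1 (_ : lift _ _ = 1) //.
exact/val_inj.
Qed.

Lemma size_lin_monom e : (size (lin_monom e) <= (\sum_j e j).+1)%N.
Proof.
rewrite lin_monomE !big_ord_recl big_ord0 addn0 (_ : lift _ _ = 1); last exact/val_inj.
apply: leq_trans (size_polyMleq _ _) _.
move: (size_lin_exp 0 (e 0)) (size_lin_exp 1 (e 1)).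
move: (size (polyseq (_ ^+ e 0))) (size (polyseq (_ ^+ e 1))) => x y.
by move: (e 0) (e 1); clear; lia.
Qed.

Lemma pt_eval_lin_monom o e :
  pt_eval (\sum_j e j) o (lin_monom e) = \prod_j pt_vec o 0 j ^+ e j.
Proof.
rewrite lin_monomE !big_ord_recl !big_ord0 addn0 mulr1.
rewrite (_ : lift _ _ = 1); last exact/val_inj.
by rewrite pt_evalM ?size_lin_exp // !pt_eval_lin_exp.
Qed.
End OneFactor.
End Chart.

(** * Dehomogenization of bihomogeneous forms *)

Section Dehomogenization.
Variable k : closedFieldType.
Variables s1 s2 : k.
Implicit Types (f g h t : cox k) (F : {poly {poly k}}) (o : option k) (a b : nat).

Definition dehom_var (i : 'I_(2 + 2)) : {poly {poly k}} :=
  match split i with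
  | inl j => map_poly polyC (lin s1 j)
  | inr j => (lin s2 j)%:P
  end.

Definition dehom f : {poly {poly k}} := mmap (polyC \o polyC) dehom_var f.

Lemma dehomD f g : dehom (f + g) = dehom f + dehom g. Proof. exact: rmorphD. Qed.
Lemma dehomN f : dehom (- f) = - dehom f. Proof. exact: rmorphN. Qed.
Lemma dehomM f g : dehom (f * g) = dehom f * dehom g. Proof. exact: rmorphM. Qed.
Lemma dehomX f n : dehom (f ^+ n) = dehom f ^+ n. Proof. exact: rmorphXn. Qed.
Lemma dehom_sum (I : Type) (r : seq I) (P : pred I) (f_ : I -> cox k) :
  dehom (\sum_(i <- r | P i) f_ i) = \sum_(i <- r | P i) dehom (f_ i).
Proof. exact: rmorph_sum. Qed.
Lemma dehomC (c : k) : dehom c%:MP = c%:P%:P. Proof. by rewrite /dehom mmapC. Qed.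

Lemma dehom_varl j : dehom_var (lshift 2 j) = map_poly polyC (lin s1 j).
Proof. by rewrite /dehom_var (unsplitK (inl j)). Qed.

Lemma dehom_varr j : dehom_var (rshift 2 j) = (lin s2 j)%:P.
Proof. by rewrite /dehom_var (unsplitK (inr j)). Qed.

Lemma dehom_x j : dehom (xvar k j) = map_poly polyC (lin s1 j).
Proof. by rewrite /dehom mmapX mmap1U dehom_varl. Qed.

Lemma dehom_y j : dehom (yvar k j) = (lin s2 j)%:P.
Proof. by rewrite /dehom mmapX mmap1U dehom_varr. Qed.

(** The value at a point of P^1 x P^1 of the form of bidegree [(a, b)] that dehomogenizes to [F]; at
    infinity a top coefficient replaces evaluation. *)
Definition bi_eval a b o1 o2 F : k :=
  pt_eval b o2 (if o1 is Some x then F.[x%:P] else F`_a).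

Lemma bi_eval_sum a b o1 o2 (I : eqType) (r : seq I) (F_ : I -> {poly {poly k}}) :
  bi_eval a b o1 o2 (\sum_(i <- r) F_ i) = \sum_(i <- r) bi_eval a b o1 o2 (F_ i).
Proof.
by case: o1 o2 => [x|] [y|]; rewrite /bi_eval /=;
  rewrite ?horner_sum ?coef_sum ?horner_sum ?coef_sum.
Qed.

Lemma bi_eval_tensor a b o1 o2 (c : k) (p q : {poly k}) :
  bi_eval a b o1 o2 (c%:P%:P * (map_poly polyC p * q%:P))
  = c * (pt_eval a o1 p * pt_eval b o2 q).
Proof.
by case: o1 o2 => [x|] [y|]; rewrite /bi_eval /=;
  rewrite ?(hornerM, coefCM, coefMC, hornerC, horner_map, coef_map) /=;
  rewrite ?(hornerM, coefCM, coefMC, hornerC).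
Qed.

Lemma dehomE f : dehom f = \sum_(e <- msupp f) (f@_e)%:P%:P *
  (map_poly polyC (lin_monom s1 (fun j => e (lshift 2 j)))
   * (lin_monom s2 (fun j => e (rshift 2 j)))%:P).
Proof.
rewrite /dehom /mmap; apply: eq_bigr => e _; congr (_ * _).
rewrite /mmap1 big_split_ord /lin_monom !rmorph_prod /=.
by congr (_ * _); apply: eq_bigr => j _; rewrite rmorphXn /= ?dehom_varl ?dehom_varr.
Qed.

Lemma dehom_bounded a b f : bihomog (a%:Z, b%:Z) f -> bounded a.+1 b.+1 (dehom f).
Proof.
move=> /allP Hf; rewrite dehomE big_seq; apply: big_ind => [||e /Hf /eqP[<- <-]].
- exact: bounded0.
- exact: boundedD.
move=> r s rs; rewrite coefCM coefMC coef_map coefCM /= coefCM.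
have := size_lin_monom s1 (fun j => e (lshift 2 j)).
have := size_lin_monom s2 (fun j => e (rshift 2 j)).
case/orP: rs => [ra _ sa|sb sb' _].
  by rewrite [X in _ * (X * _)]nth_default ?mul0r ?mulr0 // (leq_trans sa).
by rewrite [X in _ * (_ * X)]nth_default ?mulr0 // (leq_trans sb').
Qed.

(** Checked on monomials, which split into one factor for each P^1. *)
Lemma dehom_eval a b o1 o2 f : bihomog (a%:Z, b%:Z) f ->
  bi_eval a b o1 o2 (dehom f) = f.@[row_mx (pt_vec s1 o1) (pt_vec s2 o2) 0].
Proof.
move=> /allP Hf; rewrite dehomE bi_eval_sum mevalE; apply: eq_big_seq => e.
move=> /Hf/eqP[<- <-]; rewrite bi_eval_tensor !pt_eval_lin_monom; congr (_ * _).
rewrite big_split_ord /=; congr (_ * _); apply: eq_bigr => j _.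
  by rewrite row_mxEl.
by rewrite row_mxEr.
Qed.

(** Homogenization in these charts: the forms [x1] and [x0 - s1 x1] dehomogenize to the outer
    variable and to 1, and likewise in y. *)
Definition hom_forms a b F : cox k :=
  \sum_(r < a.+1) \sum_(t < b.+1) (F`_r`_t)%:MP *
   ((xvar k 1 ^+ r * (xvar k 0 - s1%:MP * xvar k 1) ^+ (a - r)) *
    (yvar k 1 ^+ t * (yvar k 0 - s2%:MP * yvar k 1) ^+ (b - t))).

Lemma bihomog_sum (I : finType) d (F_ : I -> cox k) :
  (forall i, bihomog d (F_ i)) -> bihomog d (\sum_i F_ i).
Proof.
move=> H; apply: (big_ind (fun p => bihomog d p)) => [|f g|//].
  exact: bihomog0.
exact: bihomogD.
Qed.

Lemma hom_forms_bihomog a b F : bihomog (a%:Z, b%:Z) (hom_forms a b F).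
Proof.
apply: bihomog_sum => r; apply: bihomog_sum => t; rewrite -[X in bihomog X _]add0r.
apply: bihomogM; first exact: bihomogC.
have X0 : bihomog (1, 0) (xvar k 0 - s1%:MP * xvar k 1).
  apply: bihomogD; first exact: bihomog_xvar.
  rewrite -mulNr -mpolyCN -[X in bihomog X _]add0r.
  by apply: bihomogM; [apply: bihomogC | apply: bihomog_xvar].
have Y0 : bihomog (0, 1) (yvar k 0 - s2%:MP * yvar k 1).
  apply: bihomogD; first exact: bihomog_yvar.
  rewrite -mulNr -mpolyCN -[X in bihomog X _]add0r.
  by apply: bihomogM; [apply: bihomogC | apply: bihomog_yvar].
have -> : (a%:Z, b%:Z) = (((1, 0) : int * int) *+ r + ((1, 0) : int * int) *+ (a - r))
    + (((0, 1) : int * int) *+ t + ((0, 1) : int * int) *+ (b - t)).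
  have := ltn_ord r; have := ltn_ord t; rewrite !ltnS => tb ra.
  by rewrite -!mulrnDr !subnKC // !pairMnE /= !mul0rn !pmulrn; congr pair => /=; lia.
apply: bihomogM; apply: bihomogM; apply: bihomogX => //.
  exact: bihomog_xvar.
exact: bihomog_yvar.
Qed.

Lemma hom_formsK a b F : bounded a.+1 b.+1 F -> dehom (hom_forms a b F) = F.
Proof.
move=> HF.
have X1 : dehom (xvar k 1) = 'X by rewrite dehom_x /lin /= map_polyX.
have Y1 : dehom (yvar k 1) = 'X%:P by rewrite dehom_y.
have X0 : dehom (xvar k 0 - s1%:MP * xvar k 1) = 1.
  rewrite dehomD dehomN dehomM X1 dehomC dehom_x /lin /= rmorphD rmorph1 /= -mul_polyC.
  by rewrite rmorphM /= map_polyX map_polyC /= addrK.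
have Y0 : dehom (yvar k 0 - s2%:MP * yvar k 1) = 1.
  rewrite dehomD dehomN dehomM Y1 dehomC dehom_y /lin /= -mul_polyC.
  by rewrite polyCD polyCM addrK.
have expand (R : nzRingType) n (p : {poly R}) :
    (size p <= n)%N -> p = \sum_(i < n) p`_i *: 'X^i.
  move=> sp; rewrite -poly_def; apply/polyP => i; rewrite coef_poly.
  by case: ltnP => // /(leq_trans sp) ?; rewrite nth_default.
have [sF sFr] := (boundedP _ _ _).1 HF.
rewrite [RHS](expand _ _ _ sF) /hom_forms dehom_sum; apply: eq_bigr => r _.
rewrite [in RHS](expand _ _ _ (sFr r)) dehom_sum scaler_suml; apply: eq_bigr => t _.
rewrite !(dehomM, dehomX) X0 Y0 X1 Y1 dehomC !expr1n !mulr1 mulrCA mulrC.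
by rewrite -rmorphXn /= -polyCM mul_polyC mul_polyC.
Qed.
End Dehomogenization.

(** * The tame pair of polynomials attached to a virtual complete intersection *)

Section Transport.
Variable k : closedFieldType.

Lemma closed_field_fresh (r : seq k) : exists x, x \notin r.
Proof.
have p0 : \prod_(a <- r) ('X - a%:P) != 0 by rewrite monic_neq0 ?monic_prod_XsubC.
by case/closed_nonrootP: p0 => x; rewrite root_prod_XsubC; exists x.
Qed.

(** The point at infinity [(s : 1)] has slope [s], so any [s] other than the slopes of [ls] works.
    The point [(1 : 0)] gets slope 0 through division by 0, which merely excludes one more value. *)
Lemma exists_chart (ls : seq (P1 k)) : exists s, forall l, l \in ls -> l != pt s None.
Proof.
pose slope (l : P1 k) : k := (vpick (val l)) 0 0 / (vpick (val l)) 0 1.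
have [s Hs] := closed_field_fresh (map slope ls).
exists s => l lls; apply: contra Hs => /eqP El; apply/mapP; exists l => //.
have : vpick (val l) \in <[pt_vec s None]>%VS.
  by rewrite -[<[_]>%VS]/(val (pt s None)) -El memv_pick.
case/vlineP => c Ec; rewrite /slope Ec !mxE /= mulr1.
have c0 : c != 0.
  have : vpick (val l) != 0.
    by rewrite vpick0 El /= -dimv_eq0 (eqP (pt_subproof s None)).
  by apply: contraNneq => c0; rewrite Ec c0 scale0r.
by rewrite mulrAC mulfV ?mul1r.
Qed.

Variables (X : {fset P1xP1 k}) (s1 s2 : k).
Hypothesis Xs1 : forall z, z \in X -> z.1 != pt s1 None.
Hypothesis Xs2 : forall z, z \in X -> z.2 != pt s2 None.
Implicit Types (z : P1xP1 k) (o : option k).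

Definition coords z : k * k := (chart s1 z.1, chart s2 z.2).
Definition affine_points : seq (k * k) := [seq coords z | z <- X].
Definition mk_point o1 o2 : P1xP1 k := (pt s1 o1, pt s2 o2).

Lemma coordsK z : z \in X -> mk_point (Some (coords z).1) (Some (coords z).2) = z.
Proof. by case: z => z1 z2 zX; rewrite /mk_point !chartK ?(Xs1 zX) ?(Xs2 zX). Qed.

Lemma coords_inj : {in X &, injective coords}.
Proof. by move=> z w zX wX E; rewrite -(coordsK zX) E coordsK. Qed.

Lemma uniq_affine_points : uniq affine_points.
Proof. by rewrite map_inj_in_uniq ?fset_uniq //; apply: coords_inj. Qed.

Lemma mk_point_frame o1 o2 : frame (mk_point o1 o2) (pt_vec s1 o1) (pt_vec s2 o2).
Proof. by []. Qed.

Lemma vanishes_dehom a b o1 o2 (h : cox k) : bihomog (a%:Z, b%:Z) h ->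
  vanishes h (mk_point o1 o2) <-> bi_eval a b o1 o2 (dehom s1 s2 h) = 0.
Proof.
move=> Hh; rewrite (vanishesP Hh (mk_point_frame o1 o2)).
by rewrite (dehom_eval _ _ _ _ Hh).
Qed.

Lemma vanishing_hom_forms a b F : bounded a.+1 b.+1 F -> vanish affine_points F ->
  vanishing_ideal X (hom_forms s1 s2 a b F).
Proof.
move=> HF VF z zX; rewrite -(coordsK zX).
rewrite (vanishes_dehom _ _ (hom_forms_bihomog _ _ _ _ _)) hom_formsK //.
by apply: (VF (coords z)); apply: map_f.
Qed.

Lemma count_onE (L : pred (P1xP1 k)) : count_on X L = count L X.
Proof.
rewrite /count_on -size_filter; apply/perm_size/uniq_perm.
- exact: fset_uniq.
- by rewrite filter_uniq ?fset_uniq.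
by move=> z; rewrite !inE mem_filter andbC.
Qed.

Section Intersection.
Variables (f g : cox k) (a b c d : nat) (df dg : int * int).
Hypotheses (Hf : bihomog (a%:Z, b%:Z) f) (Hg : bihomog (c%:Z, d%:Z) g).
Hypothesis iso :
  sheaf_isomorphic (cyclic_module (@vanishing_ideal k X)) (coker1 (koszul df dg f g)).
Let F := dehom s1 s2 f.
Let G := dehom s1 s2 g.

(** Some [t * h] that is nonzero at [z] lies in (f, g), by [koszul_local]. *)
Lemma no_common_zero z i j h : vanishing_ideal X h -> bihomog (i%:Z, j%:Z) h ->
  ~ vanishes h z -> ~ (vanishes f z /\ vanishes g z).
Proof.
move=> Xh Hh hz; have [e [t [u [w [Ht tz E]]]]] := koszul_local z iso Xh Hh.
have [v [v' Fr]] := frame_exists z.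
rewrite (vanishesP Hf Fr) (vanishesP Hg Fr) => -[fz gz].
apply: (nvanishesM Ht Hh tz hz); apply/(vanishesP (bihomogM Ht Hh) Fr).
by rewrite E mevalD !mevalM fz gz !mulr0 addr0.
Qed.

(** [no_common_zero] is applied to the product of the linear factors at the x-coordinates of [X] if
    [o1 = None], at the y-coordinates if [o2 = None]. It vanishes on [X] and, being monic, not at
    infinity. *)
Lemma no_zero_at_infinity o1 o2 : o1 = None \/ o2 = None ->
  ~~ ((bi_eval a b o1 o2 F == 0) && (bi_eval c d o1 o2 G == 0)).
Proof.
move=> inf; apply/negP => /andP[/eqP F0 /eqP G0].
have zfg : vanishes f (mk_point o1 o2) /\ vanishes g (mk_point o1 o2).
  by split; [apply/(vanishes_dehom _ _ Hf) | apply/(vanishes_dehom _ _ Hg)].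
have monic_top (r : seq k) : (\prod_(x <- r) ('X - x%:P))`_(size r) = 1.
  have := monic_prod_XsubC r xpredT id; rewrite monicE /lead_coef size_prod_XsubC.
  by move/eqP.
have size_lin_prod (r : seq k) : (size (\prod_(x <- r) ('X - x%:P))%R <= (size r).+1)%N.
  by rewrite size_prod_XsubC.
case: inf => E; subst.
- pose r := [seq chart s1 z.1 | z <- X]; pose P := \prod_(x <- r) ('X - x%:P).
  have HP : bounded (size r).+1 1 (map_poly polyC P).
    apply/boundedP; split=> [|i]; first by rewrite size_map_poly size_lin_prod.
    by rewrite coef_map (leq_trans (size_polyC_leq1 _)).
  have VP : vanish affine_points (map_poly polyC P).
    move=> _ /mapP[z zX ->]; rewrite /ev horner_map hornerC; apply/rootP.
    by rewrite root_prod_XsubC; apply: map_f.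
  have HH := hom_forms_bihomog s1 s2 (size r) 0 (map_poly polyC P).
  apply: (no_common_zero (vanishing_hom_forms HP VP) HH _ zfg).
  rewrite (vanishes_dehom _ _ HH) hom_formsK //; apply/eqP.
  have := bi_eval_tensor (size r) 0 None o2 1 P 1.
  rewrite !polyC1 !mul1r mulr1 => ->; rewrite /= monic_top mul1r.
  by case: (o2) => [y|] /=; rewrite ?hornerE ?coef1 oner_neq0.
- pose r := [seq chart s2 z.2 | z <- X]; pose P := \prod_(x <- r) ('X - x%:P).
  have HP : bounded 1 (size r).+1 P%:P.
    apply/boundedP; split=> [|i]; first by rewrite (leq_trans (size_polyC_leq1 _)).
    by rewrite coefC; case: ifP => _; rewrite ?size_lin_prod ?size_poly0.
  have VP : vanish affine_points P%:P.
    move=> _ /mapP[z zX ->]; rewrite /ev hornerC; apply/rootP.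
    by rewrite root_prod_XsubC; apply: (map_f (fun z => chart s2 z.2)).
  have HH := hom_forms_bihomog s1 s2 0 (size r) P%:P.
  apply: (no_common_zero (vanishing_hom_forms HP VP) HH _ zfg).
  rewrite (vanishes_dehom _ _ HH) hom_formsK //; apply/eqP.
  have := bi_eval_tensor 0 (size r) o1 None 1 1 P.
  rewrite !polyC1 rmorph1 !mul1r => ->; rewrite /= monic_top mulr1.
  by case: (o1) => [y|] /=; rewrite ?hornerE ?coef1 oner_neq0.
Qed.

(** Over an algebraically closed field, top coefficients that are not coprime share a root, which
    would be a common zero at infinity. *)
Lemma dehom_tame : tame a b c d F G.
Proof.
split; try exact: dehom_bounded.
- apply: Pdiv.ClosedField.root_coprimep => y; rewrite rootE => Fy.
  have := @no_zero_at_infinity None (Some y) (or_introl erefl).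
  by rewrite /bi_eval /= Fy.
- apply: Pdiv.ClosedField.root_coprimep => x; rewrite rootE => Fx.
  have := @no_zero_at_infinity (Some x) None (or_intror erefl).
  by rewrite /bi_eval /= !coef_horner_swap Fx.
- by have := @no_zero_at_infinity None None (or_introl erefl); rewrite negb_and.
Qed.

(** One direction is [koszul_vanishing] for [f] and [g]; for the other, [koszul_local] supplies the
    multipliers that [ideal_of_local] asks for. *)
Lemma vanish_iff_in_ideal H : vanish affine_points H <-> in_ideal F G H.
Proof.
split=> [|[u [v ->]] _ /mapP[z zX ->]]; last first.
  have V h i j (Hh : bihomog (i%:Z, j%:Z) h) (Xh : vanishing_ideal X h) :
      ev (dehom s1 s2 h) (coords z) = 0.
    have := Xh z zX; rewrite -{1}(coordsK zX).
    by move/(vanishes_dehom _ _ Hh).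
  rewrite evD !evM (V _ _ _ Hf) ?(V _ _ _ Hg) ?mulr0 ?addr0 //.
    by apply: (koszul_vanishing iso _ Hg); exists 0, 1; rewrite mul0r mul1r add0r.
  by apply: (koszul_vanishing iso _ Hf); exists 1, 0; rewrite mul0r mul1r addr0.
apply: (ideal_of_local dehom_tame) => {}H [x y] VH.
have [i [j Hij]] := bounded_ex H.
have {}Hij : bounded i.+1 j.+1 H by apply: boundedW Hij.
have HH := hom_forms_bihomog s1 s2 i j H.
have [e [t [u [w [Ht tz E]]]]] :=
  koszul_local (mk_point (Some x) (Some y)) iso (vanishing_hom_forms Hij VH) HH.
exists (dehom s1 s2 t); last first.
  exists (dehom s1 s2 u), (dehom s1 s2 w).
  by rewrite -[H in LHS](hom_formsK s1 s2 Hij) -dehomM E dehomD !dehomM.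
(* Nonzero forms have natural numbers as degrees, as evaluation in the chart requires. *)
have t0 : t != 0 by apply/eqP => t0; apply: tz; rewrite t0 => ? ? _ _; rewrite meval0.
have [i' [j' Ee]] := bihomog_natdeg Ht t0; rewrite {}Ee in Ht.
by apply/eqP => t1; apply: tz; apply/(vanishes_dehom _ _ Ht).
Qed.
End Intersection.
End Transport.

Theorem theorem4p1 (k : closedFieldType) (X : {fset P1xP1 k}) (m n : nat) :
  X <> fset0 ->
  is_max_on X (@horizontal_ruling k) m ->
  is_max_on X (@vertical_ruling k) n ->
  (#|` X| < m * n)%N ->
  ~ (gcdn m n %| #|` X|)%N ->
  ~ virtual_complete_intersection X.
Proof.
move=> X0 [[q Eq] maxq] [[p Ep] maxp] lt ndvd [df [dg [f [g [Hf Hg [_ _ iso]]]]]].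
apply: ndvd.
(* A zero form may come with negative degrees and is given bidegree [(0, 0)] instead; the Koszul
   complex in [iso] keeps [df] and [dg]. *)
have natdeg d (h : cox k) : bihomog d h -> exists a b : nat, bihomog (a%:Z, b%:Z) h.
  move=> Hh; have [->|h0] := eqVneq h 0; first by exists 0%N, 0%N; apply: bihomog0.
  by have [a [b E]] := bihomog_natdeg Hh h0; exists a, b; rewrite -E.
have [a [b {}Hf]] := natdeg _ _ Hf; have [c [d {}Hg]] := natdeg _ _ Hg.
have [s1 Xs1] := exists_chart [seq z.1 | z <- X].
have [s2 Xs2] := exists_chart [seq z.2 | z <- X].
have {}Xs1 z (zX : z \in X) := Xs1 _ (map_f _ zX).
have {}Xs2 z (zX : z \in X) := Xs2 _ (map_f _ zX).
have T := dehom_tame Xs1 Xs2 Hf Hg iso.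
have HX := vanish_iff_in_ideal Xs1 Xs2 Hf Hg iso.
have cardX : size (affine_points X s1 s2) = #|` X| by rewrite size_map.
have [z0 z0X] : exists z, z \in X by apply/fset0Pn/eqP.
have pos (L : pred (P1xP1 k)) z : z \in X -> L z -> (0 < count_on X L)%N.
  by move=> zX Lz; rewrite count_onE -has_count; apply/hasP; exists z.
have m_pos : (0 < m)%N by apply: leq_trans (maxq z0.2); apply: pos z0X _; apply: eqxx.
have n_pos : (0 < n)%N by apply: leq_trans (maxp z0.1); apply: pos z0X _; apply: eqxx.
rewrite -cardX; apply: (gcd_dvd_card (x := chart s1 p) (y := chart s2 q) T _ HX).
- exact: uniq_affine_points.
- rewrite count_map -Eq count_onE; apply: eq_in_count => z zX /=.
  (* Since [m] is positive, the ruling over [q] meets [X]; so [q] is not at infinity and is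
     determined by its chart coordinate. *)
  have [z' z'X /eqP Ez'] : exists2 z', z' \in X & z'.2 == q.
    by move: m_pos; rewrite -Eq count_onE -has_count => /hasP.
  apply/eqP/eqP => [E|-> //].
  by rewrite -(chartK (Xs2 _ zX)) E -Ez' chartK ?Xs2.
- rewrite count_map -Ep count_onE; apply: eq_in_count => z zX /=.
  have [z' z'X /eqP Ez'] : exists2 z', z' \in X & z'.1 == p.
    by move: n_pos; rewrite -Ep count_onE -has_count => /hasP.
  apply/eqP/eqP => [E|-> //].
  by rewrite -(chartK (Xs1 _ zX)) E -Ez' chartK ?Xs1.
- by rewrite cardX.
Qed.
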